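(* Under the setting and Assumptions A1–A4 described in the context, let $\{\mathcal{X}^t\}_{t\in\mathbb{N}}$ be the sequence generated by the TNNR iteration. Then: (i) $\{\mathcal{X}^t\}$ is bounded and has at least one accumulation point, i.e. there exist $\mathcal{X}^\star$ and a subsequence $\{\mathcal{X}^{t_l}\}$ with $\lim_{l\to\infty}\mathcal{X}^{t_l}=\mathcal{X}^\star$; (ii) the sequence $\{F(\mathcal{X}^t)\}$ is convergent; (iii) every accumulation point $\mathcal{X}^\star=\lim_{l\to\infty}\mathcal{X}^{t_l}$ of $\{\mathcal{X}^t\}$ is a stationary point of $F$, i.e. $0\in\partial F(\mathcal{X}^\star)$ (limiting subdifferential), and moreover $F(\mathcal{X}^{t_l+1})\to F(\mathcal{X}^\star)$ as $l\to\infty$.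
   Context: Tensors: fix positive integers $n_1,n_2,n_3$, let $r=\min\{n_1,n_2\}$. For $\mathcal{X}\in\mathbb{R}^{n_1\times n_2\times n_3}$, $\|\mathcal{X}\|$ is the Frobenius norm (square root of the sum of squared entries) and $\langle\cdot,\cdot\rangle$ the entrywise inner product. $\bar{\mathcal{X}}\in\mathbb{C}^{n_1\times n_2\times n_3}$ is the (unnormalized) discrete Fourier transform of $\mathcal{X}$ along the third mode, $\bar{\mathcal{X}}(i,j,:)=F_{n_3}\mathcal{X}(i,j,:)$ with $F_{n_3}$ the $n_3\times n_3$ DFT matrix $(\omega^{(p-1)(q-1)})_{p,q}$, $\omega=e^{-2\pi\sqrt{-1}/n_3}$; $\bar X^{(k)}$ is its $k$-th frontal slice, and $\sigma_i^k(\mathcal{X})$ denotes the $i$-th largest singular value of $\bar X^{(k)}$, $i\in[r]$, $k\in[n_3]$. Assumption A1: $\rho:[0,\infty)\to[0,\infty)$ is differentiable and concave, $\rho'$ is Lipschitz continuous with constant $L_g$, and $\rho'(t)>0$ for all $t\ge 0$. Assumption A2: $f:\mathbb{R}^{n_1\times n_2\times n_3}\to[0,\infty)$ is continuously differentiable and $\nabla f$ is $L_f$-Lipschitz ($L_f>0$). Objective: for $\lambda>0$, $F(\mathcal{X})=\lambda\sum_{k=1}^{n_3}\rho\Big(\sum_{i=1}^r\rho\big(\rho(\sigma_i^k(\mathcal{X}))\big)\Big)+f(\mathcal{X})$. Assumption A3: $F$ is coercive ($F(\mathcal{X})\to+\infty$ as $\|\mathcal{X}\|\to\infty$) and bounded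 below. Weighted function: for weights $\alpha=(\alpha_k)_{k\in[n_3]}$, $\beta=(\beta_i^k)$, $\|\mathcal{X}\|_{\rho_\alpha^\beta}=\sum_{k=1}^{n_3}\sum_{i=1}^r\alpha_k\beta_i^k\rho(\sigma_i^k(\mathcal{X}))$. TNNR iteration: start from $\mathcal{X}^0$ and set $\mathcal{X}^{-1}=\mathcal{X}^0$; for every $t\ge 0$ the weights are $\alpha_k^t=\rho'\big(\sum_{i=1}^r\rho(\rho(\sigma_i^k(\mathcal{X}^t)))\big)$, $\beta_i^{k,t}=\rho'\big(\rho(\sigma_i^k(\mathcal{X}^t))\big)$, and $\mathcal{Y}^t=\mathcal{X}^t+\theta_1^t(\mathcal{X}^t-\mathcal{X}^{t-1})$, $\mathcal{Z}^t=\mathcal{X}^t+\theta_2^t(\mathcal{X}^t-\mathcal{X}^{t-1})$, $\mathcal{X}^{t+1}\in\arg\min_{\mathcal{X}}\ \lambda\|\mathcal{X}\|_{\rho_{\alpha^t}^{\beta^t}}+\langle\mathcal{X}-\mathcal{Y}^t,\nabla f(\mathcal{Z}^t)\rangle+\frac{\mu^t}{2}\|\mathcal{X}-\mathcal{Y}^t\|^2$ (a global minimizer). Assumption A4: for some fixed $\varepsilon\in(0,1)$ and all $t$: $\theta_1^t\in[0,(1-\varepsilon)/2)$, $\theta_2^t\in[0,1/2]$, $(\mu^t)$ is nonincreasing and $\mu^0\ge\mu^t\ge\max\{\theta_2^tL_f/\theta_1^t,\ (1-\theta_2^t)L_f/(1-\theta_1^t-\theta_1^{t+1}-\varepsilon)\}$.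 *)

(* Defs.v *)
(* MathComp + MathComp-Analysis (R : realType), complex numbers R[i]
   from mathcomp-real-closed. *)
From mathcomp Require Import all_boot all_order all_algebra.
From mathcomp Require Import all_classical all_reals all_analysis.
From mathcomp Require Import complex.
Import Order.TTheory GRing.Theory Num.Theory.
Import numFieldNormedType.Exports.
Local Open Scope classical_set_scope.
Local Open Scope ring_scope.

Set Implicit Arguments.
Unset Strict Implicit.
Unset Printing Implicit Defensive.

(* A third-order real tensor in R^{n1 x n2 x n3}, given by its n3 frontal
   slices: X k is the k-th frontal slice (an n1 x n2 real matrix), so the
   entry (i,j,k) of the paper is X k i j (0-based indices). *)
Definition tensor (R : realType) (n1 n2 n3 : nat) := 'I_n3 -> 'M[R]_(n1, n2).

Section Tensors.
Variables (R : realType) (n1 n2 n3 : nat).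
Local Notation T := (tensor R n1 n2 n3).

(* entrywise inner product and Frobenius norm *)
Definition tdot (X Y : T) : R :=
  \sum_(k < n3) \sum_(i < n1) \sum_(j < n2) X k i j * Y k i j.
Definition tnorm (X : T) : R := Num.sqrt (tdot X X).

(* tensor operations (pointwise) *)
Definition tadd (X Y : T) : T := fun k => X k + Y k.
Definition tsub (X Y : T) : T := fun k => X k - Y k.
Definition tscale (a : R) (X : T) : T := fun k => a *: X k.
Definition tzero : T := fun _ => 0.

(* omega = e^{-2 pi sqrt(-1)/n3} *)
Definition dft_omega : R[i] :=
  (cos (2 * pi / n3%:R) -i* sin (2 * pi / n3%:R))%C.

(* unnormalized DFT along the third mode; k-th frontal slice of Xbar,
   Xbar(i,j,k) = sum_q omega^{k q} X(i,j,q)   (0-based indices) *)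
Definition tdft (X : T) (k : 'I_n3) : 'M[R[i]]_(n1, n2) :=
  \matrix_(i < n1, j < n2)
     \sum_(q < n3) dft_omega ^+ (k * q) * ((X q i j)%:C)%C.
End Tensors.

(* ---------- singular values of a complex matrix ---------- *)

Lemma char_poly_split (C : closedFieldType) (n : nat) (M : 'M[C]_n) :
  exists s : seq C, char_poly M == \prod_(z <- s) ('X - z%:P).
Proof.
have [s Hs] := closed_field_poly_normal (char_poly M).
exists s; apply/eqP; rewrite {1}Hs.
by rewrite (monicP (char_poly_monic M)) scale1r.
Qed.

(* the eigenvalues of a square complex matrix, listed with algebraic
   multiplicity (roots of the characteristic polynomial) *)
Definition eigenvalues (C : closedFieldType) (n : nat) (M : 'M[C]_n) : seq C :=
  xchoose (char_poly_split M).

(* conjugate transpose *)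
Definition conjT (R : realType) (m n : nat) (A : 'M[R[i]]_(m, n)) :
  'M[R[i]]_(n, m) := (map_mx (fun z => (z^*)%C) A)^T.

(* singular values of A in nonincreasing order: square roots of the
   eigenvalues of A^* A (which are real and nonnegative), sorted in
   nonincreasing order; singval A i is the (i+1)-th largest singular value
   (meaningful for i < min(m,n)). *)
Definition singvals (R : realType) (m n : nat) (A : 'M[R[i]]_(m, n)) : seq R :=
  sort (fun x y : R => y <= x)
       [seq Num.sqrt (complex.Re z) | z <- eigenvalues (conjT A *m A)].
Definition singval (R : realType) (m n : nat) (A : 'M[R[i]]_(m, n)) (i : nat) : R :=
  nth 0 (singvals A) i.

(* sigma_i^k(X): i-th largest singular value of the k-th frontal slice of
   the Fourier transformed tensor *)
Definition tsigma (R : realType) (n1 n2 n3 : nat) (X : tensor R n1 n2 n3)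
  (k : 'I_n3) (i : nat) : R := singval (tdft X k) i.

(* ---------- the objective ---------- *)
Definition objF (R : realType) (n1 n2 n3 : nat) (lam : R) (rho : R -> R)
  (f : tensor R n1 n2 n3 -> R) (X : tensor R n1 n2 n3) : R :=
  lam * (\sum_(k < n3)
           rho (\sum_(i < minn n1 n2) rho (rho (tsigma X k i))))
  + f X.

(* weighted function ||X||_{rho_alpha^beta} *)
Definition wnorm (R : realType) (n1 n2 n3 : nat) (rho : R -> R)
  (alpha : 'I_n3 -> R) (beta : 'I_n3 -> nat -> R) (X : tensor R n1 n2 n3) : R :=
  \sum_(k < n3) \sum_(i < minn n1 n2) alpha k * beta k i * rho (tsigma X k i).

(* ---------- subdifferentials ---------- *)
(* Frechet (regular) subdifferential, written out:
   V in dhat F(X) iff liminf_{Y -> X, Y <> X}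
      (F Y - F X - <V, Y - X>) / ||Y - X|| >= 0 *)
Definition frechet_subdiff (R : realType) (n1 n2 n3 : nat)
  (F : tensor R n1 n2 n3 -> R) (X V : tensor R n1 n2 n3) : Prop :=
  forall eps : R, 0 < eps -> exists2 delta : R, 0 < delta &
    forall Y, tnorm (tsub Y X) < delta ->
      - (eps * tnorm (tsub Y X)) <= F Y - F X - tdot V (tsub Y X).

(* convergence of a sequence of tensors in the Frobenius norm *)
Definition tcvg (R : realType) (n1 n2 n3 : nat)
  (u : nat -> tensor R n1 n2 n3) (L : tensor R n1 n2 n3) : Prop :=
  tnorm (tsub (u t) L) @[t --> \oo] --> (0 : R).

(* limiting (Mordukhovich) subdifferential *)
Definition limiting_subdiff (R : realType) (n1 n2 n3 : nat)
  (F : tensor R n1 n2 n3 -> R) (X V : tensor R n1 n2 n3) : Prop :=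
  exists (Xs Vs : nat -> tensor R n1 n2 n3),
    [/\ tcvg Xs X, F (Xs t) @[t --> \oo] --> F X, tcvg Vs V &
        forall t, frechet_subdiff F (Xs t) (Vs t)].

(* ---------- assumptions, written out ---------- *)

(* rho' is the derivative of rho on [0, oo) (one-sided at 0) *)
Definition deriv_on_nonneg (R : realType) (rho rho' : R -> R) : Prop :=
  forall t, 0 <= t -> forall eps : R, 0 < eps -> exists2 delta : R, 0 < delta &
    forall s, 0 <= s -> `|s - t| < delta ->
      `|rho s - rho t - rho' t * (s - t)| <= eps * `|s - t|.

Definition concave_on_nonneg (R : realType) (rho : R -> R) : Prop :=
  forall x y a : R, 0 <= x -> 0 <= y -> 0 <= a <= 1 ->
    a * rho x + (1 - a) * rho y <= rho (a * x + (1 - a) * y).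

(* g is the gradient of f (Frechet differentiability w.r.t. the Frobenius
   norm and the entrywise inner product) *)
Definition is_gradient (R : realType) (n1 n2 n3 : nat)
  (f : tensor R n1 n2 n3 -> R) (g : tensor R n1 n2 n3 -> tensor R n1 n2 n3) : Prop :=
  forall X (eps : R), 0 < eps -> exists2 delta : R, 0 < delta &
    forall Y, tnorm (tsub Y X) < delta ->
      `|f Y - f X - tdot (g X) (tsub Y X)| <= eps * tnorm (tsub Y X).

(* ---------- the TNNR iteration ---------- *)
(* X^{t-1}, with the convention X^{-1} = X^0 *)
Definition Xprev (R : realType) (n1 n2 n3 : nat) (X : nat -> tensor R n1 n2 n3)
  (t : nat) : tensor R n1 n2 n3 :=
  if t is t'.+1 then X t' else X 0%N.

(* extrapolated point X^t + theta (X^t - X^{t-1}) *)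
Definition extrap (R : realType) (n1 n2 n3 : nat) (X : nat -> tensor R n1 n2 n3)
  (theta : nat -> R) (t : nat) : tensor R n1 n2 n3 :=
  tadd (X t) (tscale (theta t) (tsub (X t) (Xprev X t))).

(* weights alpha_k^t and beta_i^{k,t} *)
Definition alphaw (R : realType) (n1 n2 n3 : nat) (rho rho' : R -> R)
  (Xt : tensor R n1 n2 n3) (k : 'I_n3) : R :=
  rho' (\sum_(i < minn n1 n2) rho (rho (tsigma Xt k i))).
Definition betaw (R : realType) (n1 n2 n3 : nat) (rho rho' : R -> R)
  (Xt : tensor R n1 n2 n3) (k : 'I_n3) (i : nat) : R :=
  rho' (rho (tsigma Xt k i)).

(* the subproblem objective at step t *)
Definition subproblem (R : realType) (n1 n2 n3 : nat) (lam : R) (rho rho' : R -> R)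
  (gradf : tensor R n1 n2 n3 -> tensor R n1 n2 n3)
  (X : nat -> tensor R n1 n2 n3) (theta1 theta2 mu : nat -> R) (t : nat)
  (W : tensor R n1 n2 n3) : R :=
  let Y := extrap X theta1 t in
  let Z := extrap X theta2 t in
  lam * wnorm rho (alphaw rho rho' (X t)) (betaw rho rho' (X t)) W
  + tdot (tsub W Y) (gradf Z) + mu t / 2 * tnorm (tsub W Y) ^+ 2.

(* X is a sequence generated by the TNNR iteration: every X^{t+1} is a
   global minimizer of the step-t subproblem *)
Definition TNNR_sequence (R : realType) (n1 n2 n3 : nat) (lam : R) (rho rho' : R -> R)
  (gradf : tensor R n1 n2 n3 -> tensor R n1 n2 n3)
  (X : nat -> tensor R n1 n2 n3) (theta1 theta2 mu : nat -> R) : Prop :=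
  forall t W, subproblem lam rho rho' gradf X theta1 theta2 mu t (X t.+1)
              <= subproblem lam rho rho' gradf X theta1 theta2 mu t W.

(* Main.v *)
(* The weights are chosen so that, by concavity of rho, the weighted function
   at X^t majorizes the penalty of F up to a constant, with equality at X^t; together with the
   descent lemma for f at the extrapolated points this makes
   F(X^t) + (mu^t theta_1^t / 2) ||X^t - X^{t-1}||^2 decrease by a multiple of
   ||X^{t+1} - X^t||^2, which gives (i), (ii) and X^{t+1} - X^t -> 0.

   For (iii) no subdifferential calculus for spectral functions is needed.
   Singular values are 1-Lipschitz (Weyl), so the minimality of X^{t+1} passes to
   the limit: X_star minimizes the weighted function with the limit weights, plus
   the linearization of f at X_star, up to a quadratic term. By the chain rule the
   penalty of F and this weighted function have the same first-order expansion at
   X_star, so 0 is even a Frechet subgradient of F at X_star. *)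
Require Import Defs.
From mathcomp Require Import all_boot all_order all_algebra.
From mathcomp Require Import all_classical all_reals all_analysis.
From mathcomp Require Import complex.
From mathcomp Require Import ring lra.
Import Order.TTheory GRing.Theory Num.Theory.
Import numFieldNormedType.Exports.
Local Open Scope classical_set_scope.
Local Open Scope ring_scope.

Set Implicit Arguments.
Unset Strict Implicit.
Unset Printing Implicit Defensive.

(** * Euclidean norms of finite real families *)

Section EuclideanNorm.
Variables (R : realType) (I : finType).
Implicit Types a b : I -> R.

Definition l2norm a : R := Num.sqrt (\sum_i a i ^+ 2).

Lemma sum_sqr_ge0 a : 0 <= \sum_i a i ^+ 2.
Proof. by apply: sumr_ge0 => i _; exact: sqr_ge0. Qed.

Lemma l2norm_ge0 a : 0 <= l2norm a.
Proof. exact: sqrtr_ge0. Qed.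

Lemma sqr_l2norm a : l2norm a ^+ 2 = \sum_i a i ^+ 2.
Proof. by rewrite sqr_sqrtr// sum_sqr_ge0. Qed.

Lemma normr_le_l2norm a i : `|a i| <= l2norm a.
Proof.
rewrite -sqrtr_sqr ler_wsqrtr// (bigD1 i)//= lerDl.
by apply: sumr_ge0 => j _; exact: sqr_ge0.
Qed.

Lemma l2norm_le a b : (forall i, `|a i| <= `|b i|) -> l2norm a <= l2norm b.
Proof.
move=> ab; apply: ler_wsqrtr; apply: ler_sum => i _.
by rewrite -(real_normK (num_real (a i))) -(real_normK (num_real (b i)))
  ler_pXn2r ?nnegrE.
Qed.

(** The factor [#|I|], cruder than its square root, suffices because later only the existence of a
    Lipschitz constant matters. *)
Lemma l2norm_le_const a (c : R) :
  (forall i, `|a i| <= c) -> l2norm a <= #|I|%:R * c.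
Proof.
(* An index is what shows that [c] is nonnegative; over an empty [I] both sides vanish. *)
move=> ac; have [i0|] := pickP (@predT I); last first.
  move=> I0; rewrite /l2norm big_pred0// sqrtr0.
  by rewrite (eq_card0 I0) mul0r.
move=> _; have c0 : 0 <= c by apply: le_trans (ac i0).
have n1 : 1 <= #|I|%:R :> R by rewrite ler1n; apply/card_gt0P; exists i0.
rewrite -(ler_pXn2r (ltn0Sn 1)) ?nnegrE ?l2norm_ge0 ?mulr_ge0//.
rewrite sqr_l2norm (@le_trans _ _ (\sum_(i : I) c ^+ 2))//.
  apply: ler_sum => i _.
  by rewrite -(real_normK (num_real (a i))) ler_pXn2r ?nnegrE.
rewrite sumr_const -[_ *+ _]mulr_natl exprMn ler_wpM2r ?sqr_ge0//.
by rewrite expr2 ler_peMl.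
Qed.

(** With [A] and [B] the two norms, the sum of the squares of [a i * B - b i * A] equals
    [2 * (A * B)] times the gap [A * B - \sum_i a i * b i]. If [A * B = 0], one family is zero. *)
Lemma cauchy_schwarz a b : \sum_i a i * b i <= l2norm a * l2norm b.
Proof.
set A := l2norm a; set B := l2norm b.
have A0 : 0 <= A := l2norm_ge0 a; have B0 : 0 <= B := l2norm_ge0 b.
have [/eqP|AB] := eqVneq (A * B) 0.
  rewrite mulf_eq0 => AB0; rewrite big1 ?mulr_ge0// => i _.
  case/orP: AB0 => /eqP E.
    have := normr_le_l2norm a i; rewrite -/A E normr_le0 => /eqP->.
    by rewrite mul0r.
  have := normr_le_l2norm b i; rewrite -/B E normr_le0 => /eqP->.
  by rewrite mulr0.
have ABp : 0 < A * B by rewrite lt_neqAle eq_sym AB mulr_ge0.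
have : 0 <= \sum_i (a i * B - b i * A) ^+ 2 by exact: sum_sqr_ge0.
have -> : \sum_i (a i * B - b i * A) ^+ 2 =
   2 * (A * B) * (A * B - \sum_i a i * b i).
  transitivity (\sum_i (a i ^+ 2 * B ^+ 2 + b i ^+ 2 * A ^+ 2
                 - 2 * (A * B) * (a i * b i))).
    by apply: eq_bigr => i _; ring.
  rewrite sumrB big_split/= -!mulr_suml -mulr_sumr -!sqr_l2norm -/A -/B.
  by ring.
by rewrite pmulr_rge0 ?subr_ge0// mulr_gt0.
Qed.

Lemma l2norm_triangle a b :
  l2norm (fun i => a i + b i) <= l2norm a + l2norm b.
Proof.
rewrite -(ler_pXn2r (ltn0Sn 1)) ?nnegrE ?l2norm_ge0 ?addr_ge0 ?l2norm_ge0//.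
rewrite sqr_l2norm sqrrD !sqr_l2norm.
have -> : \sum_i (a i + b i) ^+ 2 =
  \sum_i a i ^+ 2 + (\sum_i a i * b i) *+ 2 + \sum_i b i ^+ 2.
  rewrite -sumrMnl -!big_split/=; apply: eq_bigr => i _; ring.
by rewrite lerD2r lerD2l lerMn2r/= cauchy_schwarz.
Qed.

End EuclideanNorm.

(** * Singular values of complex matrices and their perturbation *)

Section SingularValues.
Variable R : realType.
Local Notation C := R[i].
Local Notation normc := (@ComplexField.Normc.normc R).

(** Applied to row vectors, it also serves as the Euclidean norm on complex n-space. *)
Definition frob (m n : nat) (A : 'M[C]_(m, n)) : R :=
  l2norm (fun p : 'I_m * 'I_n => normc (A p.1 p.2)).

Lemma normc_ge0 (z : C) : 0 <= normc z.
Proof. by case: z => x y; exact: sqrtr_ge0. Qed.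

Lemma normcJ (z : C) : normc (z^*)%C = normc z.
Proof. by case: z => x y /=; rewrite sqrrN. Qed.

Lemma sqr_frob (m n : nat) (A : 'M[C]_(m, n)) :
  frob A ^+ 2 = \sum_i \sum_j normc (A i j) ^+ 2.
Proof. by rewrite sqr_l2norm pair_big. Qed.

Lemma frob_ge0 (m n : nat) (A : 'M[C]_(m, n)) : 0 <= frob A.
Proof. exact: l2norm_ge0. Qed.

Lemma frob_triangle (m n : nat) (A B : 'M[C]_(m, n)) :
  frob (A + B) <= frob A + frob B.
Proof.
apply: le_trans (l2norm_triangle _ _); apply: l2norm_le => p.
rewrite !ger0_norm ?addr_ge0 ?normc_ge0// mxE.
exact: le_normcD.
Qed.

Lemma normc_sum (I : finType) (z : I -> C) :
  normc (\sum_i z i) <= \sum_i normc (z i).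
Proof.
elim/big_ind2 : _ => //; first by rewrite ComplexField.Normc.normc0.
by move=> x1 x2 y1 y2 h1 h2; apply: le_trans (le_normcD _ _) (lerD h1 h2).
Qed.

Lemma frob_mulmx_row (m n : nat) (x : 'rV[C]_m) (A : 'M[C]_(m, n)) :
  frob (x *m A) <= frob x * frob A.
Proof.
rewrite -(ler_pXn2r (ltn0Sn 1)) ?nnegrE ?mulr_ge0 ?frob_ge0// exprMn !sqr_frob.
rewrite !big_ord1 exchange_big/= mulr_sumr; apply: ler_sum => j _.
rewrite mxE.
have := normc_sum (fun k => x 0 k * A k j).
rewrite [X in _ <= X -> _]
  (eq_bigr (fun k => normc (x 0 k) * normc (A k j))); last first.
  by move=> k _; rewrite ComplexField.Normc.normcM.
move=> h; have {h} := le_trans h (cauchy_schwarz _ _).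
move/(lerXn2r 2); rewrite !nnegrE mulr_ge0 ?normc_ge0 ?l2norm_ge0//.
move=> /(_ isT isT).
by rewrite exprMn !sqr_l2norm.
Qed.

Lemma frob_gt0 (m n : nat) (x : 'M[C]_(m, n)) : x != 0 -> 0 < frob x.
Proof.
move=> x0; rewrite lt_neqAle frob_ge0 andbT eq_sym; apply: contra x0 => /eqP fx.
apply/eqP/matrixP => i j; rewrite mxE.
apply: ComplexField.Normc.eq0_normc.
apply/eqP; rewrite eq_le normc_ge0 andbT -fx.
exact: le_trans (ler_norm _) (normr_le_l2norm (fun p => normc (x p.1 p.2)) (i, j)).
Qed.

Lemma frob_conjT (m n : nat) (A : 'M[C]_(m, n)) : frob (conjT A) = frob A.
Proof.
apply/eqP; rewrite -(eqrXn2 (ltn0Sn 1)) ?frob_ge0// !sqr_frob exchange_big/=.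
by apply/eqP; apply: eq_bigr => i _; apply: eq_bigr => j _; rewrite !mxE normcJ.
Qed.

Lemma mulmx_conjT_row (n : nat) (x : 'rV[C]_n) :
  (x *m conjT x) 0 0 = ((frob x ^+ 2)%:C)%C.
Proof.
rewrite sqr_frob big_ord1 mxE rmorph_sum/=; apply: eq_bigr => j _.
by rewrite !mxE -sqr_normc rmorphXn.
Qed.

Lemma conjTM (m n p : nat) (A : 'M[C]_(m, n)) (B : 'M[C]_(n, p)) :
  conjT (A *m B) = conjT B *m conjT A.
Proof. by rewrite /conjT map_mxM trmx_mul. Qed.

Lemma conjTK (m n : nat) (A : 'M[C]_(m, n)) : conjT (conjT A) = A.
Proof. by apply/matrixP => i j; rewrite !mxE conjcK. Qed.

(** Over the polynomial ring the scalar matrix ['X%:M] commutes with [P], so the characteristic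
    matrix itself is conjugated, and determinants multiply. *)
Lemma char_poly_similar (F : fieldType) (n : nat) (P M : 'M[F]_n) :
  P \in unitmx -> char_poly (invmx P *m M *m P) = char_poly M.
Proof.
move=> Pu; rewrite /char_poly /char_poly_mx !map_mxM/=.
have PQ : map_mx polyC (invmx P) *m map_mx polyC P = 1%:M.
  by rewrite -map_mxM mulVmx// map_mx1.
have {1}-> : 'X%:M = map_mx polyC (invmx P) *m 'X%:M *m map_mx polyC P.
  by rewrite scalar_mxC -mulmxA PQ mulmx1.
rewrite -mulmxBl -mulmxBr !det_mulmx mulrAC -det_mulmx PQ.
by rewrite det1 mul1r.
Qed.

(* The columns of [P] are orthonormal eigenvectors of [A^* A]. *)
Lemma singvals_spectral (m n : nat) (A : 'M[C]_(m, n)) :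
  exists (P : 'M[C]_n) (s : 'I_n -> R),
  [/\ forall j, 0 <= s j,
      perm_eq (singvals A) [seq s j | j <- enum 'I_n],
      forall x : 'rV_n, frob (x *m P) = frob x &
      forall x : 'rV_n, frob (x *m conjT A) ^+ 2 =
        \sum_j (s j * normc ((x *m P) 0 j)) ^+ 2].
Proof.
set H := conjT A *m A.
have conjT_tC k l (B : 'M[C]_(k, l)) : conjT B = map_mx Num.conj B^T.
  by apply/matrixP => i j; rewrite !mxE.
have Hnorm : H \is normalmx.
  by apply/normalmxP; rewrite -conjT_tC /H conjTM conjTK.
set Q := spectralmx H; set d := spectral_diag H.
have HE : H = invmx Q *m diag_mx d *m Q by apply/orthomx_spectralP.
have Qu : Q \is unitarymx := spectral_unitarymx H.
have QQ : Q *m conjT Q = 1%:M by rewrite conjT_tC; apply/unitarymxP.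
have invQ : invmx Q = conjT Q by rewrite conjT_tC invmx_unitary.
have QQ' : conjT Q *m Q = 1%:M by rewrite -invQ mulVmx// spectral_unit.
(* Defining [s j] as a norm makes it real and nonnegative at once; [dE] identifies its square with
   the eigenvalue [d 0 j]. *)
pose s j := frob (row j (Q *m conjT A)).
have dE j : d 0 j = ((s j ^+ 2)%:C)%C.
  have : (Q *m H *m conjT Q) j j = d 0 j.
    by rewrite HE invQ !mulmxA QQ mul1mx -mulmxA QQ mulmx1 mxE eqxx mulr1n.
  move=> <-; rewrite /H mulmxA -mulmxA.
  have -> : A *m conjT Q = conjT (Q *m conjT A) by rewrite conjTM conjTK.
  rewrite /s sqr_frob big_ord1 mxE rmorph_sum; apply: eq_bigr => k _.
  by rewrite !mxE -sqr_normc rmorphXn.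
exists (conjT Q), s; split.
- by move=> j; exact: frob_ge0.
- rewrite /singvals perm_sort.
  (* [eigenvalues] is a chosen list, known only through the product of its linear factors; equal
     products give equal lists up to permutation. *)
  have /prod_XsubC_eq pe : \prod_(z <- eigenvalues H) ('X - z%:P) =
      \prod_(z <- [seq d 0 j | j <- enum 'I_n]) ('X - z%:P).
    rewrite /eigenvalues -(eqP (xchooseP (char_poly_split H))).
    rewrite HE char_poly_similar ?spectral_unit// char_poly_trig; last first.
      exact/is_diag_mx_is_trig/diag_mx_is_diag.
    rewrite big_map -big_enum/=; apply: eq_bigr => j _.
    by rewrite mxE eqxx mulr1n.
  apply: (perm_trans (perm_map _ pe)); rewrite -map_comp.
  apply/permP => p; rewrite !count_map; apply: eq_count => j /=.
  by rewrite dE /= sqrtr_sqr ger0_norm ?frob_ge0.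
- move=> x; apply/eqP; rewrite -(eqrXn2 (ltn0Sn 1)) ?frob_ge0//.
  have /complexI -> // : (((frob (x *m conjT Q) ^+ 2)%:C) = (frob x ^+ 2)%:C)%C.
  rewrite -!mulmx_conjT_row conjTM conjTK -!mulmxA (mulmxA (conjT Q)) QQ'.
  by rewrite mul1mx.
- move=> x; apply: complexI; rewrite -mulmx_conjT_row conjTM conjTK.
  rewrite -!mulmxA (mulmxA (conjT A)) -/H HE invQ !mulmxA -mulmxA.
  have -> : Q *m conjT x = conjT (x *m conjT Q) by rewrite conjTM conjTK.
  set y := x *m conjT Q; rewrite mxE rmorph_sum; apply: eq_bigr => j _.
  rewrite mul_mx_diag !mxE dE exprMn [RHS](rmorphM (real_complex R)) [RHS]mulrC.
  rewrite mulrAC; congr (_ * _).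
  by rewrite -sqr_normc rmorphXn.
Qed.

Lemma kernel_vector (n m : nat) (K : 'M[C]_(n, m)) :
  (m < n)%N -> exists2 x : 'rV_n, x != 0 & x *m K = 0.
Proof.
move=> mn; have : kermx K != 0.
  rewrite -mxrank_eq0 mxrank_ker subn_eq0 -ltnNge.
  exact: leq_ltn_trans (rank_leq_col K) mn.
by move=> /rowV0Pn[x /sub_kermxP xK x0]; exists x.
Qed.

(** The first [i.+1] entries all qualify, since the list is nonincreasing. *)
Lemma sorted_count_ge (s : seq R) (i : nat) :
  sorted (fun x y : R => y <= x) s -> (i < size s)%N ->
  (i < count (fun x => nth 0 s i <= x)%R s)%N.
Proof.
move=> ss si; rewrite -{2}(cat_take_drop i.+1 s) count_cat.
apply: leq_trans (leq_addr _ _).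
have st : size (take i.+1 s) = i.+1 by rewrite size_takel.
rewrite -[X in (X <= _)%N]st.
suff : all (fun x => nth 0 s i <= x) (take i.+1 s) by rewrite all_count => /eqP ->.
apply/(all_nthP 0) => j; rewrite st => ji; rewrite nth_take//.
apply: (sorted_leq_nth (leT := fun x y : R => y <= x)) => //.
- by move=> x y z h1 h2; apply: le_trans h1.
- by rewrite inE; apply: leq_ltn_trans si; rewrite -ltnS.
Qed.

(** From position [i] on, no entry exceeds the one at [i], so only the first [i] positions can
    count. *)
Lemma sorted_count_gt (s : seq R) (i : nat) :
  sorted (fun x y : R => y <= x) s -> (i < size s)%N ->
  (count (fun x => nth 0 s i < x)%R s <= i)%N.
Proof.
move=> ss si; rewrite -{2}(cat_take_drop i s) count_cat.
have -> : count (fun x => nth 0 s i < x) (drop i s) = 0%N.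
  apply/eqP; rewrite -leqn0 leqNgt -has_count; apply/hasPn => x.
  move=> /(nthP 0)[j]; rewrite size_drop => ji <-; rewrite nth_drop -leNgt.
  apply: (sorted_leq_nth (leT := fun x y : R => y <= x)) => //.
  - by move=> a b c h1 h2; apply: le_trans h1.
  - by rewrite inE -ltn_subRL.
  - by rewrite leq_addr.
by rewrite addn0 (leq_trans (count_size _ _))// size_take si.
Qed.

(* Fewer than [n] linear conditions make [x] orthogonal both to the eigenvectors
   of [A^* A] with singular value below the [i]-th and to those of [B^* B] with
   singular value above the [i]-th; a nonzero such [x] compares the two. *)
Lemma singval_le (m n : nat) (A B : 'M[C]_(m, n)) (i : nat) :
  (i < n)%N -> singval A i <= singval B i + frob (A - B).
Proof.
move=> ltin.
have [P [s [s0 ps Pn PA]]] := singvals_spectral A.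
have [Q [t [t0 pt Qn QB]]] := singvals_spectral B.
set a := singval A i; set b := singval B i.
have srt k l (D : 'M[C]_(k, l)) : sorted (fun x y : R => y <= x) (singvals D).
  by apply: sort_sorted => x y; exact: le_total.
have b0 : 0 <= b.
  rewrite /b /singval; have : nth 0 (singvals B) i \in singvals B.
    by apply: mem_nth; rewrite (perm_size pt) size_map size_enum_ord.
  by rewrite (perm_mem pt) => /mapP[j _ ->].
have [b_a|a_b] := ltP b a; last by apply: le_trans a_b _; rewrite lerDl frob_ge0.
(* With strict inequalities in both sets, repeated singular values do no harm: [S] has at most
   [n - i - 1] elements and [T] at most [i]. *)
pose S := [pred j | s j < a]; pose T := [pred j | b < t j].
have cS : (#|S| + i < n)%N.
  have := sorted_count_ge (srt _ _ A) (i := i).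
  rewrite (perm_size ps) size_map size_enum_ord => /(_ ltin).
  rewrite -/(singval A i) -/a (permP ps) count_map.
  rewrite -[X in (_ < X)%N -> _]size_filter /=.
  have -> : size [seq j <- enum 'I_n | a <= s j] = #|[predC S]|.
    rewrite cardE enumT /enum_mem -enumT; congr size; apply: eq_filter => j.
    by rewrite !inE -leNgt.
  move=> h; rewrite -[X in (_ < X)%N](card_ord n) -(cardC S).
  by rewrite ltn_add2l.
have cT : (#|T| <= i)%N.
  have := sorted_count_gt (srt _ _ B) (i := i).
  rewrite (perm_size pt) size_map size_enum_ord => /(_ ltin).
  rewrite -/(singval B i) -/b (permP pt) count_map.
  rewrite -[X in (X <= _)%N -> _]size_filter /=.
  by rewrite cardE enumT /enum_mem -enumT.
pose K := row_mx (colsub (enum_val (A := S)) P) (colsub (enum_val (A := T)) Q).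
have [|x x0] := @kernel_vector _ _ K.
  by apply: leq_ltn_trans cS; rewrite leq_add2l.
rewrite mul_mx_row -[X in _ = X]row_mx0 => /eq_row_mx[xP xQ].
have xS j : s j < a -> (x *m P) 0 j = 0.
  move=> sj; have Sj : j \in S by [].
  have /matrixP/(_ 0 (enum_rank_in Sj j)) := xP.
  by rewrite mulmx_colsub !mxE enum_rankK_in// mxE.
have xT j : b < t j -> (x *m Q) 0 j = 0.
  move=> sj; have Sj : j \in T by [].
  have /matrixP/(_ 0 (enum_rank_in Sj j)) := xQ.
  by rewrite mulmx_colsub !mxE enum_rankK_in// mxE.
clearbody a b.
have a0 : 0 <= a := le_trans b0 (ltW b_a).
have fx := frob_gt0 x0.
(* The coordinates of [x *m P] with [s j < a] vanish, so every weight that remains is at least [a];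
   [hi] is the mirror image for [B]. *)
have lo : a * frob x <= frob (x *m conjT A).
  rewrite -(ler_pXn2r (ltn0Sn 1)) ?nnegrE ?mulr_ge0 ?frob_ge0//.
  rewrite PA -Pn exprMn sqr_frob big_ord1 mulr_sumr; apply: ler_sum => j _.
  rewrite -exprMn; have [/xS ->|sj] := ltP (s j) a.
    by rewrite ComplexField.Normc.normc0 !mulr0.
  by rewrite ler_pXn2r ?nnegrE ?mulr_ge0 ?normc_ge0// ler_wpM2r ?normc_ge0.
have hi : frob (x *m conjT B) <= b * frob x.
  rewrite -(ler_pXn2r (ltn0Sn 1)) ?nnegrE ?mulr_ge0 ?frob_ge0//.
  rewrite QB -Qn exprMn sqr_frob big_ord1 mulr_sumr; apply: ler_sum => j _.
  rewrite -exprMn; have [/xT ->|sj] := ltP b (t j).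
    by rewrite ComplexField.Normc.normc0 !mulr0.
  by rewrite ler_pXn2r ?nnegrE ?mulr_ge0 ?normc_ge0// ler_wpM2r ?normc_ge0.
rewrite -(ler_pM2r fx); apply: le_trans lo _.
have -> : x *m conjT A = x *m conjT B + x *m conjT (A - B).
  rewrite -mulmxDr; congr (_ *m _); apply/matrixP => k l.
  by rewrite !mxE rmorphB addrC subrK.
apply: le_trans (frob_triangle _ _) _; rewrite mulrDl; apply: lerD => //.
by rewrite mulrC -(frob_conjT (A - B)) frob_mulmx_row.
Qed.

(** Weyl's perturbation inequality, with the Frobenius norm in place of the spectral norm. *)
Lemma singval_lipschitz (m n : nat) (A B : 'M[C]_(m, n)) (i : nat) :
  (i < n)%N -> `|singval A i - singval B i| <= frob (A - B).
Proof.
move=> ltin; have h1 := singval_le A B ltin; have h2 := singval_le B A ltin.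
have E : frob (B - A) = frob (A - B).
  congr Num.sqrt; apply: eq_bigr => p _; congr (_ ^+ 2).
  by rewrite !mxE -opprB normcN.
move: h1 h2; rewrite E; move: (singval A i) (singval B i) (frob _) => a b c h1 h2.
by rewrite ler_norml; apply/andP; split; lra.
Qed.

End SingularValues.

(** * Limits of finite sums and of subsequences *)

Lemma cvgr_sum (R : realType) (I : Type) (r : seq I) (P : pred I)
    (u : I -> nat -> R) (l : I -> R) :
  (forall i, P i -> u i t @[t --> \oo] --> l i) ->
  \sum_(i <- r | P i) u i t @[t --> \oo] --> \sum_(i <- r | P i) l i.
Proof. by apply: cvg_big; exact: add_continuous. Qed.

(** By induction, [n <= phi n]. *)
Lemma cvgn_strictly_increasing (phi : nat -> nat) :
  {homo phi : m n / (m < n)%N} -> phi l @[l --> \oo] --> \oo.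
Proof.
move=> phi_inc; apply/cvgnyPge => A; exists A => // n /= An.
apply: (leq_trans An) => {An}; elim: n => // n IH.
exact: leq_ltn_trans IH (phi_inc _ _ (ltnSn n)).
Qed.

(** * Geometry and compactness of the tensor space; regularity of [tsigma] *)

Section TensorNorm.
Variables (R : realType) (n1 n2 n3 : nat).
Local Notation T := (tensor R n1 n2 n3).
Local Notation idx := ('I_n3 * ('I_n1 * 'I_n2))%type.
Implicit Types X Y Z : T.

(** Flattening the triple sum to a single index type makes the results on [l2norm] applicable. *)
Lemma tdotE X Y : tdot X Y =
  \sum_(p : idx) X p.1 p.2.1 p.2.2 * Y p.1 p.2.1 p.2.2.
Proof.
rewrite /tdot -(pair_bigA _ (fun k q => X k q.1 q.2 * Y k q.1 q.2))/=.
by apply: eq_bigr => k _; rewrite pair_bigA.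
Qed.

Lemma tnormE X : tnorm X = l2norm (fun p : idx => X p.1 p.2.1 p.2.2).
Proof.
by rewrite /tnorm tdotE /l2norm; congr Num.sqrt; apply: eq_bigr => p _; rewrite expr2.
Qed.

Lemma tnorm_ge0 X : 0 <= tnorm X.
Proof. exact: sqrtr_ge0. Qed.

Lemma tdot_ge0 X : 0 <= tdot X X.
Proof. by rewrite tdotE; apply: sumr_ge0 => p _; rewrite -expr2 sqr_ge0. Qed.

Lemma sqr_tnorm X : tnorm X ^+ 2 = tdot X X.
Proof. by rewrite sqr_sqrtr// tdot_ge0. Qed.

Lemma tentry_le_tnorm X k i j : `|X k i j| <= tnorm X.
Proof.
rewrite tnormE; exact: (normr_le_l2norm (fun p : idx => X p.1 p.2.1 p.2.2) (k, (i, j))).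
Qed.

Lemma tdot_le X Y : tdot X Y <= tnorm X * tnorm Y.
Proof. by rewrite tdotE !tnormE cauchy_schwarz. Qed.

Lemma tdotC X Y : tdot X Y = tdot Y X.
Proof. by rewrite !tdotE; apply: eq_bigr => p _; rewrite mulrC. Qed.

Lemma tdotBl X Y Z : tdot (tsub X Y) Z = tdot X Z - tdot Y Z.
Proof. by rewrite !tdotE -sumrB; apply: eq_bigr => p _; rewrite !mxE mulrBl. Qed.

Lemma tdotZl a X Y : tdot (tscale a X) Y = a * tdot X Y.
Proof. by rewrite !tdotE mulr_sumr; apply: eq_bigr => p _; rewrite !mxE mulrA. Qed.

Lemma tdotBr X Y Z : tdot Z (tsub X Y) = tdot Z X - tdot Z Y.
Proof. by rewrite tdotC tdotBl !(tdotC Z). Qed.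

Lemma tdotZr a X Y : tdot Y (tscale a X) = a * tdot Y X.
Proof. by rewrite tdotC tdotZl (tdotC Y). Qed.

Lemma tdot0l X : tdot (@tzero R n1 n2 n3) X = 0.
Proof. by rewrite tdotE big1// => p _; rewrite mxE mul0r. Qed.

Lemma tensorP X Y : (forall k i j, X k i j = Y k i j) -> X = Y.
Proof. by move=> XY; apply/funext => k; apply/matrixP => i j. Qed.

Lemma tnormZ a X : tnorm (tscale a X) = `|a| * tnorm X.
Proof.
by rewrite /tnorm tdotZl tdotZr mulrA -expr2 sqrtrM ?sqr_ge0// sqrtr_sqr.
Qed.

Lemma tnorm_subC X Y : tnorm (tsub X Y) = tnorm (tsub Y X).
Proof.
rewrite -[LHS]mul1r -[in LHS](normrN1 R) -tnormZ; congr tnorm.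
by apply: tensorP => k i j; rewrite !mxE mulN1r opprB.
Qed.

Lemma tnorm_subxx X : tnorm (tsub X X) = 0.
Proof.
by apply/eqP; rewrite -sqrf_eq0 sqr_tnorm tdotBl subrr.
Qed.

Lemma tdot_cvg (u v : nat -> T) X Y :
  (forall k i j, u t k i j @[t --> \oo] --> X k i j) ->
  (forall k i j, v t k i j @[t --> \oo] --> Y k i j) ->
  tdot (u t) (v t) @[t --> \oo] --> tdot X Y.
Proof.
move=> uX vY; under eq_fun do rewrite tdotE; rewrite tdotE.
by apply: cvgr_sum => p _; apply: cvgM; [exact: uX|exact: vY].
Qed.

Lemma cvg_dominated0 (u e : nat -> R) (l C : R) :
  (forall t, `|u t - l| <= C * e t) -> e t @[t --> \oo] --> 0 ->
  u t @[t --> \oo] --> l.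
Proof.
move=> ue e0; apply/subr_cvg0/norm_cvg0P.
apply: (@squeeze_cvgr _ _ _ _ (fun=> 0) (fun t => C * e t)).
- by near=> t; rewrite normr_ge0 ue.
- exact: cvg_cst.
- by rewrite -(mulr0 C); apply: cvgMr.
Unshelve. all: by end_near. Qed.

Lemma tnorm_cvg0 (u : nat -> T) :
  tdot (u t) (u t) @[t --> \oo] --> (0 : R) -> tnorm (u t) @[t --> \oo] --> (0 : R).
Proof.
move=> u0; rewrite -sqrtr0 /tnorm.
by apply: (continuous_cvg _ _ u0); exact: sqrt_continuous.
Qed.

(** Passing to entries turns limits of tensor expressions into limits of real sequences. *)
Lemma tcvg_entry (u : nat -> T) X : tcvg u X <->
  (forall k i j, u t k i j @[t --> \oo] --> X k i j).
Proof.
split=> [uX k i j|uX].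
  apply: (@cvg_dominated0 _ (fun t => tnorm (tsub (u t) X)) _ 1) => // t.
  by rewrite mul1r; have := tentry_le_tnorm (tsub (u t) X) k i j; rewrite !mxE.
have dE : tdot (tsub X X) (tsub X X) = 0.
  by rewrite -sqr_tnorm tnorm_subxx expr0n.
apply: tnorm_cvg0; rewrite -dE.
by apply: tdot_cvg => k i j; under eq_fun do rewrite !mxE; rewrite !mxE;
  apply: cvgB; try exact: uX; exact: cvg_cst.
Qed.

Lemma tcvg_shift (u v : nat -> T) X : tcvg u X ->
  tcvg (fun t => tsub (v t) (u t)) (@tzero R n1 n2 n3) -> tcvg v X.
Proof.
move=> /tcvg_entry uX /tcvg_entry d0; apply/tcvg_entry => k i j.
have -> : (fun t => v t k i j) = (fun t => u t k i j + tsub (v t) (u t) k i j).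
  by apply/funext => t; rewrite !mxE; ring.
have -> : X k i j = X k i j + @tzero R n1 n2 n3 k i j by rewrite mxE addr0.
exact: cvgD (uX k i j) (d0 k i j).
Qed.

Lemma tensor_bolzano_weierstrass (u : nat -> T) (B : R) :
  (forall t, tnorm (u t) <= B) ->
  exists X (phi : nat -> nat), {homo phi : m n / (m < n)%N} /\
    tcvg (fun l => u (phi l)) X.
Proof.
move=> uB.
suff [phi phi_inc cv] : exists2 phi : nat -> nat,
    {homo phi : m n / (m < n)%N} &
    forall p : idx, cvgn (fun l => u (phi l) p.1 p.2.1 p.2.2).
  exists (fun k => \matrix_(i, j) limn (fun l => u (phi l) k i j)), phi.
  split=> //; apply/tcvg_entry => k i j; rewrite mxE.
  exact: (cv (k, (i, j))).
(* Subsequences are extracted for one entry after another, by induction on a list of indices; each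
   further extraction keeps the limits already obtained. *)
suff : forall s : seq idx, exists2 phi : nat -> nat,
    {homo phi : m n / (m < n)%N} &
    forall p, p \in s -> cvgn (fun l => u (phi l) p.1 p.2.1 p.2.2).
  move=> /(_ (enum {: idx}))[phi ? cv]; exists phi => // p; apply: cv.
  by rewrite mem_enum.
elim=> [|p s [phi phi_inc cv]]; first by exists id.
have [|psi psi_inc cpsi] :=
  @bolzano_weierstrass _ (fun l => u (phi l) p.1 p.2.1 p.2.2).
  exists B; split; first exact: num_real.
  move=> M BM t _; apply: le_trans (ltW BM); apply: le_trans (uB (phi t)).
  exact: tentry_le_tnorm.
have psi_homo : {homo psi : m n / (m < n)%N}.
  by move=> m n mn; have := leW_mono psi_inc m n; rewrite /Order.lt /= => ->.
exists (phi \o psi) => [m n mn|q]; first exact/phi_inc/psi_homo.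
rewrite inE => /orP[/eqP->//|/cv cq].
apply/cvg_ex; exists (limn (fun l => u (phi l) q.1 q.2.1 q.2.2)).
apply: (@cvg_comp _ _ _ psi (fun l => u (phi l) q.1 q.2.1 q.2.2)); last exact: cq.
exact: cvgn_strictly_increasing.
Qed.

Lemma normc_dft_omega_exp (n m : nat) :
  ComplexField.Normc.normc (dft_omega R n ^+ m) = 1.
Proof.
elim: m => [|m IH]; first by rewrite expr0 ComplexField.Normc.normc1.
rewrite exprS ComplexField.Normc.normcM IH mulr1 /=.
by rewrite sqrrN cos2Dsin2 sqrtr1.
Qed.

Lemma tsigma_lipschitz : exists2 C : R, 0 <= C &
  forall X Y k i, (i < minn n1 n2)%N ->
    `|tsigma X k i - tsigma Y k i| <= C * tnorm (tsub X Y).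
Proof.
(* Powers of [dft_omega] have modulus 1, so each entry of the transform changes by at most [n3]
   times the norm; the other factor comes from [l2norm_le_const]. *)
exists (#|{: 'I_n1 * 'I_n2}|%:R * n3%:R); first by rewrite mulr_ge0.
move=> X Y k i; rewrite leq_min => /andP[_ i2].
apply: le_trans (singval_lipschitz _ _ i2) _; rewrite -mulrA.
apply: l2norm_le_const => -[a b] /=; rewrite ger0_norm ?normc_ge0// !mxE.
rewrite -sumrB; apply: le_trans (normc_sum _) _.
rewrite -[X in X%:R * _]card_ord mulr_natl -sumr_const; apply: ler_sum => q _.
rewrite -mulrBr -rmorphB ComplexField.Normc.normcM normc_dft_omega_exp mul1r /=.
rewrite expr0n /= addr0 sqrtr_sqr.
by have := tentry_le_tnorm (tsub X Y) q a b; rewrite !mxE.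
Qed.

Lemma tsigma_ge0 X k i : 0 <= tsigma X k i.
Proof.
rewrite /tsigma /singval /singvals; set s := sort _ _.
(* Beyond the end of the list [nth] returns its default 0. *)
have [si|si] := ltnP i (size s); last by rewrite nth_default.
have := mem_nth 0 si; rewrite mem_sort => /mapP[z _ ->]; exact: sqrtr_ge0.
Qed.

End TensorNorm.

(** * Tangent and Lipschitz bounds for a concave function on the half-line *)

Section ConcaveFunction.
Variables (R : realType) (rho rho' : R -> R).
Hypothesis rho_deriv : deriv_on_nonneg rho rho'.
Hypothesis rho_concave : concave_on_nonneg rho.
Hypothesis rho'_pos : forall t, 0 <= t -> 0 < rho' t.

(** Concavity on the segment from [a] to [b] is compared with the derivative estimate at
    [a + l * (b - a)]; dividing by [l] leaves an arbitrary error [e]. *)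
Lemma concave_tangent a b : 0 <= a -> 0 <= b ->
  rho b - rho a <= rho' a * (b - a).
Proof.
move=> a0 b0; apply/ler_addgt0Pr => e e0.
have [->|ab] := eqVneq b a; first by rewrite !subrr mulr0 add0r ltW.
have n0 : 0 < `|b - a| by rewrite normr_gt0 subr_eq0.
have [d d0 hd] := rho_deriv a0 (divr_gt0 e0 n0).
(* The bound 1 allows a convex combination; halving [d] gives the strict inequality that the
   derivative estimate asks for. *)
pose l := Num.min 1 (d / 2 / `|b - a|).
have l0 : 0 < l by rewrite lt_min ltr01 !divr_gt0.
have l1 : l <= 1 by rewrite ge_min lexx.
have cv := rho_concave b0 a0 (introT andP (conj (ltW l0) l1)).
have E : l * b + (1 - l) * a = a + l * (b - a) by ring.
have s0 : 0 <= a + l * (b - a).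
  by rewrite -E addr_ge0// mulr_ge0// ?subr_ge0// ltW.
have := hd _ s0.
have -> : a + l * (b - a) - a = l * (b - a) by ring.
rewrite normrM (gtr0_norm l0) => /(_ _) hb.
have {}hb : `|rho (a + l * (b - a)) - rho a - rho' a * (l * (b - a))| <= l * e.
  apply: le_trans (hb _) _; last first.
    by rewrite mulrCA mulfVK// gt_eqF.
  apply: (@le_lt_trans _ _ (d / 2)); last first.
    by rewrite ltr_pdivrMr// mulr_natr mulr2n ltrDl.
  by rewrite -ler_pdivlMr// ge_min lexx orbT.
have h : l * (rho b - rho a) <= l * (rho' a * (b - a) + e).
  move: hb cv; rewrite E ler_norml => /andP[_]; move: (rho (a + _)) => r.
  rewrite !mulrDr !mulrN (mulrCA l) mulrBl mul1r => h1 h2.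
  by lra.
by rewrite ler_pM2l in h.
Qed.

(** The sum of the tangent inequalities at [a] and at 0 shows it, after division by [a]. *)
Lemma concave_deriv_le0 a : 0 <= a -> rho' a <= rho' 0.
Proof.
move=> a0; have h1 := concave_tangent a0 (lexx 0).
have h2 := concave_tangent (lexx 0) a0.
move: a0; rewrite le_eqVlt => /predU1P[<-//|a0].
rewrite -(ler_pM2r a0); lra.
Qed.

(** For [a <= b], positivity of [rho'] makes the increment nonnegative, and the tangent at [a] has
    slope at most [rho' 0]. *)
Lemma concave_lipschitz a b : 0 <= a -> 0 <= b ->
  `|rho a - rho b| <= rho' 0 * `|a - b|.
Proof.
wlog ab : a b / a <= b.
  move=> H a0 b0; have [ab|ba] := leP a b; first exact: H.
  by rewrite distrC (distrC a); apply: H => //; exact: ltW.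
move=> a0 b0; have h1 := concave_tangent a0 b0.
have h2 := concave_tangent b0 a0; have p := rho'_pos b0.
have ba : 0 <= b - a by rewrite subr_ge0.
have r1 : rho' a * (b - a) <= rho' 0 * (b - a).
  by rewrite ler_wpM2r// concave_deriv_le0.
have r2 : 0 <= rho' b * (b - a) by rewrite mulr_ge0// ltW.
rewrite distrC ger0_norm ?(distrC a) ?(ger0_norm ba); lra.
Qed.

End ConcaveFunction.

(** * Quadratic bounds for a function with Lipschitz gradient *)

Section DescentLemma.
Variables (R : realType) (n1 n2 n3 : nat).
Local Notation T := (tensor R n1 n2 n3).
Variables (f : T -> R) (g : T -> T) (L : R).
Hypothesis fg : is_gradient f g.

Lemma is_derive_along_line (X D : T) (s : R) :
  is_derive s 1 (fun r : R => f (tadd X (tscale r D)))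
    (tdot (g (tadd X (tscale s D))) D).
Proof.
set df := tdot _ _; set phi := fun r => _.
have cv : h^-1 *: ((phi \o shift s) (h *: 1) - phi s) @[h --> 0^'] --> df.
  apply/cvgrPdist_le => e e0.
  (* Adding 1 keeps the denominator positive when [D] is zero. *)
  have D1 : 0 < tnorm D + 1 by rewrite ltr_wpDl ?tnorm_ge0.
  have [d d0 hd] := fg (tadd X (tscale s D)) (divr_gt0 e0 D1).
  have hn : \forall h \near (0:R)^', h != 0 by exact: nbhs_dnbhs_neq.
  near=> h.
  have h0 : h != 0 by near: h.
  have hs : `|h| < d / (tnorm D + 1).
    by near: h; apply: dnbhs0_lt; rewrite divr_gt0.
  have E : tsub (tadd X (tscale (h + s) D)) (tadd X (tscale s D)) = tscale h D.
    by apply: tensorP => k i j; rewrite !mxE; ring.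
  have := hd (tadd X (tscale (h + s) D)); rewrite E tnormZ tdotZr -/df => /(_ _) hb.
  rewrite /= scaler1 -/(phi (h + s)).
  have hp : 0 < `|h| by rewrite normr_gt0.
  rewrite -(ler_pM2l hp) -normrM mulrBr.
  rewrite [h * (h^-1 *: _)](mulrA h) divff// mul1r distrC.
  apply: le_trans (hb _) _.
    apply: (@le_lt_trans _ _ (`|h| * (tnorm D + 1))).
      by rewrite ler_wpM2l// lerDl.
    by rewrite -ltr_pdivlMr.
  rewrite mulrCA ler_wpM2l// mulrAC ler_pdivrMr// ler_wpM2l ?ltW//.
  by rewrite ltrDl.
apply: DeriveDef; first by apply/cvg_ex; exists df.
exact: (cvg_lim _ cv).
Unshelve. all: by end_near. Qed.

(** Along the segment, [phi] is [f] minus the claimed quadratic bound, up to a constant. Its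
    derivative is nonpositive by Cauchy-Schwarz and the Lipschitz gradient, so the mean value
    theorem gives [phi 1 <= phi 0]. *)
Lemma descent_upper :
  (forall X Y, tnorm (tsub (g X) (g Y)) <= L * tnorm (tsub X Y)) ->
  forall X Y, f Y - f X - tdot (g X) (tsub Y X) <= L / 2 * tnorm (tsub Y X) ^+ 2.
Proof.
move=> gL X Y; set D := tsub Y X.
pose c := tdot (g X) D; pose q := tnorm D ^+ 2.
pose phi (s : R) := f (tadd X (tscale s D)) - s * c - s ^+ 2 * (L / 2 * q).
have dphi (s : R) : is_derive s 1 phi
    (tdot (g (tadd X (tscale s D))) D - c - s * (L * q)).
  have H := is_derive_along_line X D s.
  rewrite /phi; apply: is_derive_eq.
  by rewrite /GRing.scale /=; field.
have le0 (s : R) : 0 <= s -> tdot (g (tadd X (tscale s D))) D - c - s * (L * q) <= 0.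
  move=> s0; rewrite /c -tdotBl subr_le0; apply: le_trans (tdot_le _ _) _.
  have -> : s * (L * q) = (L * (s * tnorm D)) * tnorm D by rewrite /q; ring.
  apply: ler_wpM2r; first exact: tnorm_ge0.
  apply: le_trans (gL _ _) _.
  have -> : tsub (tadd X (tscale s D)) X = tscale s D.
    by apply: tensorP => k i j; rewrite !mxE; ring.
  by rewrite tnormZ ger0_norm.
have cphi : {within `[0, 1], continuous phi}.
  by apply: derivable_within_continuous => s _; exact: ex_derive.
have [s s01] := @MVT_segment _ phi _ 0 1 ler01 (fun s _ => dphi s) cphi.
rewrite subr0 mulr1 => E.
have : phi 1 - phi 0 <= 0.
  by rewrite E le0//; move: s01; rewrite in_itv /= => /andP[].
rewrite /phi.
have -> : tadd X (tscale 1 D) = Y.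
  by apply: tensorP => k i j; rewrite !mxE; ring.
have -> : tadd X (tscale 0 D) = X.
  by apply: tensorP => k i j; rewrite !mxE; ring.
by rewrite -/c -/q; clear; move: (f Y) (f X) c q (L) => fY fX c0 q0 L0; lra.
Qed.

End DescentLemma.

(** This is [descent_upper] for [- f], whose gradient has the same Lipschitz constant. *)
Lemma descent_lower (R : realType) (n1 n2 n3 : nat)
    (f : tensor R n1 n2 n3 -> R) (g : tensor R n1 n2 n3 -> tensor R n1 n2 n3)
    (L : R) :
  is_gradient f g ->
  (forall X Y, tnorm (tsub (g X) (g Y)) <= L * tnorm (tsub X Y)) ->
  forall X Y, - (L / 2 * tnorm (tsub Y X) ^+ 2) <=
    f Y - f X - tdot (g X) (tsub Y X).
Proof.
move=> fg gL X Y.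
have E W Z : tdot (tscale (-1) (g W)) Z = - tdot (g W) Z.
  by rewrite tdotZl mulN1r.
have h : is_gradient (fun X => - f X) (fun X => tscale (-1) (g X)).
  move=> W e e0; have [d d0 hd] := fg W e e0; exists d => // Z /hd.
  rewrite E -normrN; apply: le_trans; rewrite le_eqVlt; apply/orP; left.
  by apply/eqP; congr `|_|; ring.
have gL' W Z : tnorm (tsub (tscale (-1) (g W)) (tscale (-1) (g Z)))
    <= L * tnorm (tsub W Z).
  apply: le_trans (gL W Z).
  have -> : tsub (tscale (-1) (g W)) (tscale (-1) (g Z)) = tsub (g Z) (g W).
    by apply: tensorP => k i j; rewrite !mxE; ring.
  by rewrite tnorm_subC.
have := descent_upper h gL' X Y; rewrite E.
by move: (f Y) (f X) (tdot _ _) (L / 2 * _) => a b c d; lra.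
Qed.

(** * Lipschitz functions and little-o remainders on tensors *)

Section LittleO.
Variables (R : realType) (n1 n2 n3 : nat).
Local Notation T := (tensor R n1 n2 n3).
Implicit Types (u v e : T -> R) (X : T).

Definition tlipschitz u := exists2 C : R, 0 <= C &
  forall X Y, `|u X - u Y| <= C * tnorm (tsub X Y).

(** Since [Y = X] is allowed, [e X = 0] is forced. Two functions can thus share a first-order
    expansion at [X] without being differentiable there. *)
Definition tlittleo X e := forall eps : R, 0 < eps -> exists2 delta : R, 0 < delta &
  forall Y, tnorm (tsub Y X) < delta -> `|e Y| <= eps * tnorm (tsub Y X).

Lemma tlipschitz_sum (r : nat) (u : 'I_r -> T -> R) :
  (forall i, tlipschitz (u i)) -> tlipschitz (fun X => \sum_(i < r) u i X).
Proof.
elim: r u => [|r IH] u lu.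
  by exists 0 => // X Y; rewrite !big_ord0 subrr normr0 mul0r.
have [C C0 hC] := IH (fun i => u (lift ord0 i)) (fun i => lu _).
have [D D0 hD] := lu ord0.
exists (D + C); first exact: addr_ge0.
move=> X Y; rewrite !big_ord_recl opprD addrACA mulrDl.
by apply: le_trans (ler_normD _ _) (lerD _ _).
Qed.

Lemma tlipschitz_cvg u (v : nat -> T) X : tlipschitz u -> tcvg v X ->
  u (v t) @[t --> \oo] --> u X.
Proof. by move=> [C _ hC] vX; apply: cvg_dominated0 vX => t; exact: hC. Qed.

Lemma tlittleoD X e1 e2 : tlittleo X e1 -> tlittleo X e2 ->
  tlittleo X (fun Y => e1 Y + e2 Y).
Proof.
move=> o1 o2 eps eps0; have h0 : 0 < eps / 2 by rewrite divr_gt0.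
have [d1 d10 h1] := o1 _ h0; have [d2 d20 h2] := o2 _ h0.
exists (Num.min d1 d2) => [|Y]; first by rewrite lt_min d10.
rewrite lt_min => /andP[/h1 {}h1 /h2 {}h2].
by apply: le_trans (ler_normD _ _) _; rewrite [eps]splitr mulrDl lerD.
Qed.

Lemma tlittleoZ (a : R) X e : tlittleo X e -> tlittleo X (fun Y => a * e Y).
Proof.
move=> oe eps eps0; have a1 : 0 < `|a| + 1 by rewrite ltr_wpDl.
have [d d0 h] := oe _ (divr_gt0 eps0 a1); exists d => // Y /h {}h.
rewrite normrM; apply: (@le_trans _ _ ((`|a| + 1) * `|e Y|)).
  by rewrite ler_wpM2r// lerDl.
by rewrite mulrC -ler_pdivlMr// mulrAC.
Qed.

Lemma tlittleo_sum (r : nat) X (e : 'I_r -> T -> R) :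
  (forall i, tlittleo X (e i)) -> tlittleo X (fun Y => \sum_(i < r) e i Y).
Proof.
elim: r e => [|r IH] e oe.
  move=> eps eps0; exists 1 => // Y _.
  by rewrite big_ord0 normr0 mulr_ge0 ?tnorm_ge0// ltW.
under eq_fun do rewrite big_ord_recl.
exact: tlittleoD (oe ord0) (IH (fun i => e (lift ord0 i)) (fun i => oe _)).
Qed.

Lemma tlittleo_sqr (c : R) X : tlittleo X (fun Y => c * tnorm (tsub Y X) ^+ 2).
Proof.
apply: tlittleoZ => eps eps0; exists eps => // Y /ltW h.
by rewrite ger0_norm ?sqr_ge0// expr2 ler_wpM2r ?tnorm_ge0.
Qed.

Lemma tdot_norm_le X Y : `|tdot X Y| <= tnorm X * tnorm Y.
Proof.
rewrite ler_norml tdot_le andbT lerNl -mulN1r -tdotZl.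
by apply: le_trans (tdot_le _ _) _; rewrite tnormZ normrN1 mul1r.
Qed.

Lemma tdot_amgm X Y : 2 * tdot X Y <= tdot X X + tdot Y Y.
Proof.
have := tdot_ge0 (tsub X Y); rewrite !(tdotBl, tdotBr) (tdotC Y X).
by move: (tdot _ _) (tdot _ _) (tdot _ _) => *; lra.
Qed.

End LittleO.

(** * The nested penalty and its reweighted model *)

Section Penalty.
Variables (R : realType) (n1 n2 n3 : nat).
Local Notation T := (tensor R n1 n2 n3).
Variables (rho rho' : R -> R) (Lg : R).
Hypothesis rho_nonneg : forall t, 0 <= t -> 0 <= rho t.
Hypothesis rho_deriv : deriv_on_nonneg rho rho'.
Hypothesis rho_concave : concave_on_nonneg rho.
Hypothesis rho'_lip :
  forall x y, 0 <= x -> 0 <= y -> `|rho' x - rho' y| <= Lg * `|x - y|.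
Hypothesis rho'_pos : forall t, 0 <= t -> 0 < rho' t.

Lemma tlipschitz_comp_concave (u : T -> R) : (forall X, 0 <= u X) ->
  tlipschitz u -> tlipschitz (fun X => rho (u X)).
Proof.
move=> u0 [C C0 hC]; have r0 := ltW (rho'_pos (lexx 0)).
exists (rho' 0 * C) => [|X Y]; first exact: mulr_ge0.
apply: le_trans (concave_lipschitz rho_deriv rho_concave rho'_pos (u0 X) (u0 Y)) _.
by rewrite -mulrA ler_wpM2l.
Qed.

(** A chain rule that asks only for [u] to be Lipschitz: an error small against the change of [u] is
    small against the distance to [X]. Singular values are handled in this way. *)
Lemma tlittleo_comp_deriv (u : T -> R) X : (forall Y, 0 <= u Y) ->
  tlipschitz u ->
  tlittleo X (fun Y => rho (u Y) - rho (u X) - rho' (u X) * (u Y - u X)).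
Proof.
move=> u0 [C C0 hC] eps eps0; have C1 : 0 < C + 1 by rewrite ltr_wpDl.
have [d d0 hd] := rho_deriv (u0 X) (divr_gt0 eps0 C1).
exists (d / (C + 1)) => [|Y]; first by rewrite divr_gt0.
rewrite ltr_pdivlMr// => YX.
have uYX : `|u Y - u X| <= (C + 1) * tnorm (tsub Y X).
  by apply: le_trans (hC Y X) _; rewrite ler_wpM2r ?tnorm_ge0// lerDl.
apply: le_trans (hd _ (u0 Y) _) _.
  by apply: le_lt_trans uYX _; rewrite mulrC.
by rewrite mulrAC ler_pdivrMr// -mulrA ler_wpM2l ?(ltW eps0)// mulrC.
Qed.

Definition inner_sum (X : T) (k : 'I_n3) : R :=
  \sum_(i < minn n1 n2) rho (rho (tsigma X k i)).
Definition penalty (X : T) : R := \sum_(k < n3) rho (inner_sum X k).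

Lemma rho_tsigma_ge0 (X : T) k i : 0 <= rho (tsigma X k i).
Proof. exact/rho_nonneg/tsigma_ge0. Qed.

Lemma inner_sum_ge0 X k : 0 <= inner_sum X k.
Proof. by apply: sumr_ge0 => i _; exact/rho_nonneg/rho_tsigma_ge0. Qed.

Lemma tlipschitz_tsigma k (i : 'I_(minn n1 n2)) :
  tlipschitz (fun X : T => tsigma X k i).
Proof.
have [C C0 hC] := @tsigma_lipschitz R n1 n2 n3.
by exists C => // X Y; exact: hC.
Qed.

Lemma tlipschitz_rho_tsigma k (i : 'I_(minn n1 n2)) :
  tlipschitz (fun X : T => rho (tsigma X k i)).
Proof.
apply: tlipschitz_comp_concave; last exact: tlipschitz_tsigma.
by move=> X; exact: tsigma_ge0.
Qed.

Lemma tlipschitz_inner_sum k : tlipschitz (fun X => inner_sum X k).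
Proof.
apply: tlipschitz_sum => i; apply: tlipschitz_comp_concave.
  by move=> X; exact: rho_tsigma_ge0.
exact: tlipschitz_rho_tsigma.
Qed.

Lemma tlipschitz_penalty : tlipschitz penalty.
Proof.
apply: tlipschitz_sum => k; apply: tlipschitz_comp_concave.
  by move=> X; exact: inner_sum_ge0.
exact: tlipschitz_inner_sum.
Qed.

(** [V] supplies the weights and [W] the point. The model is linear in the values
    [rho (tsigma W k i)], not in [W]. *)
Definition linearized_penalty (V W : T) : R :=
  wnorm rho (alphaw rho rho' V) (betaw rho rho' V) W.

(** [outer_gap] and [inner_gap] are the tangent remainders of the outer and the middle [rho]; the
    innermost [rho] is kept exact. *)
Definition outer_gap (V W : T) k : R :=
  rho (inner_sum W k) - rho (inner_sum V k)
  - rho' (inner_sum V k) * (inner_sum W k - inner_sum V k).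
Definition inner_gap (V W : T) k i : R :=
  rho (rho (tsigma W k i)) - rho (rho (tsigma V k i))
  - rho' (rho (tsigma V k i)) * (rho (tsigma W k i) - rho (tsigma V k i)).

(** One exact identity serves twice: the signs of the gaps give majorization, and their smallness
    gives the first-order agreement. *)
Lemma penalty_linearization V W :
  penalty W - penalty V - (linearized_penalty V W - linearized_penalty V V) =
  \sum_(k < n3) (outer_gap V W k +
    rho' (inner_sum V k) * \sum_(i < minn n1 n2) inner_gap V W k i).
Proof.
have slice (r : nat) (a x y : R) (b v w rv rw : 'I_r -> R) :
    x - y - (\sum_(i < r) a * b i * w i - \sum_(i < r) a * b i * v i) =
    x - y - a * (\sum_(i < r) rw i - \sum_(i < r) rv i)
    + a * \sum_(i < r) (rw i - rv i - b i * (w i - v i)).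
  have wE (z : 'I_r -> R) :
      \sum_(i < r) a * b i * z i = a * \sum_(i < r) b i * z i.
    by rewrite mulr_sumr; apply: eq_bigr => i _; rewrite mulrA.
  have -> : \sum_(i < r) (rw i - rv i - b i * (w i - v i)) =
      \sum_(i < r) rw i - \sum_(i < r) rv i
      - (\sum_(i < r) b i * w i - \sum_(i < r) b i * v i).
    by rewrite -!sumrB; apply: eq_bigr => i _; rewrite mulrBr.
  by rewrite !wE; ring.
rewrite /penalty /linearized_penalty /wnorm -!sumrB; apply: eq_bigr => k _.
exact: (slice _ _ _ _ (fun i => rho' (rho (tsigma V k i)))
  (fun i => rho (tsigma V k i)) (fun i => rho (tsigma W k i))
  (fun i => rho (rho (tsigma V k i))) (fun i => rho (rho (tsigma W k i)))).
Qed.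

Lemma penalty_majorized V W :
  penalty W - penalty V <= linearized_penalty V W - linearized_penalty V V.
Proof.
rewrite -subr_le0 penalty_linearization; apply: sumr_le0 => k _.
have r0 := ltW (rho'_pos (inner_sum_ge0 V k)).
rewrite -[X in _ <= X]addr0; apply: lerD.
  rewrite subr_le0; apply: (concave_tangent rho_deriv rho_concave);
  exact: inner_sum_ge0.
apply: mulr_ge0_le0 => //; apply: sumr_le0 => i _.
by rewrite subr_le0; apply: (concave_tangent rho_deriv rho_concave);
  exact: rho_tsigma_ge0.
Qed.

Lemma penalty_first_order V : tlittleo V (fun W =>
  penalty W - penalty V - (linearized_penalty V W - linearized_penalty V V)).
Proof.
under [X in tlittleo _ X]eq_fun do rewrite penalty_linearization.
apply: tlittleo_sum => k; apply: tlittleoD.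
  apply: (@tlittleo_comp_deriv (fun W => inner_sum W k)).
    by move=> Y; exact: inner_sum_ge0.
  exact: tlipschitz_inner_sum.
apply: tlittleoZ; apply: tlittleo_sum => i.
apply: (@tlittleo_comp_deriv (fun W => rho (tsigma W k i))).
  by move=> Y; exact: rho_tsigma_ge0.
exact: tlipschitz_rho_tsigma.
Qed.

Lemma cvg_rho' (u : nat -> R) (l : R) : (forall t, 0 <= u t) -> 0 <= l ->
  u t @[t --> \oo] --> l -> rho' (u t) @[t --> \oo] --> rho' l.
Proof.
move=> u0 l0 ul; apply: (@cvg_dominated0 _ _ (fun t => `|u t - l|) _ Lg).
  by move=> t; exact: rho'_lip.
by apply/norm_cvg0P/subr_cvg0.
Qed.

(** The weights move along with the point; they converge because [rho'] is Lipschitz. *)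
Lemma linearized_penalty_cvg (v w : nat -> T) V W : tcvg v V -> tcvg w W ->
  linearized_penalty (v t) (w t) @[t --> \oo] --> linearized_penalty V W.
Proof.
move=> vV wW; apply: cvgr_sum => k _; apply: cvgr_sum => i _.
apply: cvgM; first apply: cvgM.
- apply: cvg_rho' => [t||]; [exact: inner_sum_ge0|exact: inner_sum_ge0|].
  exact: tlipschitz_cvg (tlipschitz_inner_sum k) vV.
- apply: cvg_rho' => [t||]; [exact: rho_tsigma_ge0|exact: rho_tsigma_ge0|].
  exact: tlipschitz_cvg (tlipschitz_rho_tsigma k i) vV.
- exact: tlipschitz_cvg (tlipschitz_rho_tsigma k i) wW.
Qed.

End Penalty.

(** * Continuity of the objective and decrease in one step *)

Section Convergence.
Variables (R : realType) (n1 n2 n3 : nat).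
Local Notation T := (tensor R n1 n2 n3).
Variables (lam : R) (hlam : 0 < lam).
Variables (rho rho' : R -> R) (Lg : R).
Hypothesis rho_nonneg : forall t, 0 <= t -> 0 <= rho t.
Hypothesis rho_deriv : deriv_on_nonneg rho rho'.
Hypothesis rho_concave : concave_on_nonneg rho.
Hypothesis rho'_lip :
  forall x y, 0 <= x -> 0 <= y -> `|rho' x - rho' y| <= Lg * `|x - y|.
Hypothesis rho'_pos : forall t, 0 <= t -> 0 < rho' t.
Variables (f : T -> R) (gradf : T -> T) (Lf : R).
Hypothesis f_grad : is_gradient f gradf.
Hypothesis gradf_lip :
  forall X Y, tnorm (tsub (gradf X) (gradf Y)) <= Lf * tnorm (tsub X Y).
Local Notation F := (objF lam rho f).
Local Notation h := (@linearized_penalty R n1 n2 n3 rho rho').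

Lemma objFE X : F X = lam * penalty rho X + f X.
Proof. by []. Qed.

Lemma objF_cvg (v : nat -> T) X : tcvg v X -> F (v t) @[t --> \oo] --> F X.
Proof.
move=> vX; apply: cvgD.
  apply: cvgMr; 
  have lip := tlipschitz_penalty n1 n2 n3 rho_nonneg rho_deriv rho_concave rho'_pos.
  exact: (tlipschitz_cvg lip vX).
(* Continuity of [f] comes from the two quadratic bounds around [X]. *)
apply: (@cvg_dominated0 _ _ (fun t => tnorm (gradf X) * tnorm (tsub (v t) X)
    + Lf / 2 * tnorm (tsub (v t) X) ^+ 2) _ 1).
  move=> t; rewrite mul1r.
  have h1 := descent_upper f_grad gradf_lip X (v t).
  have h2 := descent_lower f_grad gradf_lip X (v t).
  have := tdot_norm_le (gradf X) (tsub (v t) X); rewrite ler_norml => /andP[h3 h4].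
  move: h1 h2 h3 h4; move: (f _) (f _) (tdot _ _) (_ * _) (_ * _) => a b c d e ? ? ? ?.
  by rewrite ler_norml; apply/andP; split; lra.
have -> : (0 : R) = tnorm (gradf X) * 0 + Lf / 2 * 0 ^+ 2 by rewrite expr2; ring.
apply: cvgD; first exact: cvgMr.
apply: cvgMr; exact: (cvgM vX vX).
Qed.

(* The minimality of [X1] compared with the competitor [X0]; the smoothness
   of [f] is used at the extrapolated point [Z], forwards to [X1] and
   backwards to [X0]. *)
Lemma step_decrease (Xm X0 X1 : T) (th1 th2 mu : R) :
  let Y := tadd X0 (tscale th1 (tsub X0 Xm)) in
  let Z := tadd X0 (tscale th2 (tsub X0 Xm)) in
  let D := tsub X1 X0 in let P := tsub X0 Xm in
  lam * h X0 X1 + tdot (tsub X1 Y) (gradf Z) + mu / 2 * tnorm (tsub X1 Y) ^+ 2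
  <= lam * h X0 X0 + tdot (tsub X0 Y) (gradf Z) + mu / 2 * tnorm (tsub X0 Y) ^+ 2 ->
  F X1 - F X0 <= (Lf - mu) / 2 * tnorm D ^+ 2
    + (mu * th1 - Lf * th2) * tdot D P + Lf * th2 ^+ 2 * tnorm P ^+ 2.
Proof.
move=> Y Z D P.
have X1Y : tsub X1 Y = tsub D (tscale th1 P).
  by apply: tensorP => k i j; rewrite !mxE; ring.
have X0Y : tsub X0 Y = tscale (- th1) P.
  by apply: tensorP => k i j; rewrite !mxE; ring.
have X1Z : tsub X1 Z = tsub D (tscale th2 P).
  by apply: tensorP => k i j; rewrite !mxE; ring.
have X0Z : tsub X0 Z = tscale (- th2) P.
  by apply: tensorP => k i j; rewrite !mxE; ring.
clearbody Y Z D P.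
have := descent_upper f_grad gradf_lip Z X1.
have := descent_lower f_grad gradf_lip Z X0.
have := penalty_majorized rho_nonneg rho_deriv rho_concave rho'_pos X0 X1.
(* After expansion the products with [gradf Z] cancel, and each of the two smoothness errors
   contributes [Lf / 2 * th2 ^+ 2] times the square of [tnorm P]. *)
rewrite -(ler_pM2l hlam) X1Y X0Y X1Z X0Z !sqr_tnorm.
rewrite !(tdotBl, tdotBr, tdotZl, tdotZr) (tdotC P D).
rewrite !objFE (tdotC (gradf Z) D) (tdotC (gradf Z) P).
move: (penalty _ _) (penalty _ _) (h _ _) (h _ _) (f Z) (f X0) (f X1).
move: (tdot D P) (tdot D D) (tdot P P) (tdot D _) (tdot P _).
by clear; move=> *; nra.
Qed.

(** * The Lyapunov function along the iteration *)

Section Iteration.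
Hypothesis hLf : 0 < Lf.
Hypothesis F_coercive :
  forall M : R, exists K : R, forall X, K < tnorm X -> M < F X.
Hypothesis F_bdd_below : exists m : R, forall X, m <= F X.
Variables (X : nat -> T) (theta1 theta2 mu : nat -> R) (eps : R).
Hypothesis hX : TNNR_sequence lam rho rho' gradf X theta1 theta2 mu.
Hypothesis heps : 0 < eps < 1.
Hypothesis htheta1 : forall t, 0 <= theta1 t < (1 - eps) / 2.
Hypothesis htheta2 : forall t, 0 <= theta2 t <= 1 / 2.
Hypothesis hmu_noninc : forall t, mu t.+1 <= mu t.
Hypothesis hmu0 : forall t, mu t <= mu 0%N.
Hypothesis hmu1 : forall t, theta2 t * Lf <= mu t * theta1 t.
Hypothesis hmu2 : forall t,
  (1 - theta2 t) * Lf / (1 - theta1 t - theta1 t.+1 - eps) <= mu t.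

Let p t := tsub (X t) (Xprev X t).
(** The Lyapunov function: objective plus inertial energy. As [p 0] is zero, [E 0] is [F (X 0)]. *)
Let E t := F (X t) + mu t * theta1 t / 2 * tnorm (p t) ^+ 2.

(** The denominator in [hmu2] lies in [(0, 1]], because both values of [theta1] are below
    [(1 - eps) / 2]; its numerator is at least [Lf / 2], because [theta2 t <= 1 / 2]. *)
Lemma stepsize_bounds t :
  (1 - theta2 t) * Lf <= mu t * (1 - theta1 t - theta1 t.+1 - eps) /\
  Lf / 2 <= mu t.
Proof.
have /andP[e0 e1] := heps.
have /andP[a0 a1] := htheta1 t; have /andP[b0 b1] := htheta1 t.+1.
have /andP[c0 c1] := htheta2 t.
have d0 : 0 < 1 - theta1 t - theta1 t.+1 - eps by lra.
have H : (1 - theta2 t) * Lf <= mu t * (1 - theta1 t - theta1 t.+1 - eps).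
  by rewrite -ler_pdivrMr.
split=> //.
have L2 : Lf / 2 <= (1 - theta2 t) * Lf.
  by rewrite mulrC ler_wpM2r ?(ltW hLf)//; lra.
have mu0 : 0 < mu t.
  rewrite -(pmulr_lgt0 _ d0); apply: lt_le_trans H; apply: lt_le_trans L2.
  by rewrite divr_gt0.
apply: le_trans L2 _; apply: le_trans H _.
rewrite -[X in _ <= X]mulr1 ler_wpM2l ?(ltW mu0)//; lra.
Qed.

Lemma lyapunov_decrease t : E t.+1 + Lf * eps / 4 * tnorm (p t.+1) ^+ 2 <= E t.
Proof.
have /andP[e0 e1] := heps.
have /andP[a0 a1] := htheta1 t; have /andP[b0 b1] := htheta1 t.+1.
have /andP[c0 c1] := htheta2 t.
have [H muL] := stepsize_bounds t.
have := @step_decrease (Xprev X t) (X t) (X t.+1) (theta1 t) (theta2 t) (mu t)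
  (hX t (X t)).
rewrite /E -/(p t) /= -/(p t.+1) !sqr_tnorm.
have c2 : 2 * tdot (p t.+1) (p t) <= tdot (p t.+1) (p t.+1) + tdot (p t) (p t).
  exact: tdot_amgm.
move: (tdot_ge0 (p t)) (tdot_ge0 (p t.+1)) c2.
have := hmu1 t; have := hmu_noninc t.
change (tsub (X t.+1) (X t)) with (p t.+1).
move: (F _) (F _) (tdot (p t) _) (tdot (p t.+1) (p t)) (tdot (p t.+1) _).
move: (mu t) (mu t.+1) (theta1 t) (theta1 t.+1) (theta2 t) hLf H muL a0 a1 b0 b1 c0 c1.
move=> m m' a b c L0 H muL a0 a1 b0 b1 c0 c1 F1 F0 P Q D mm Ha P0 D0 Q2 HF.
(* Young's inequality for the cross term; [hmu1] makes its coefficient nonnegative. *)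
have Q' : (m * a - Lf * c) * Q <= (m * a - Lf * c) / 2 * (D + P).
  have : (m * a - Lf * c) * (2 * Q) <= (m * a - Lf * c) * (D + P).
    by apply: ler_wpM2l => //; lra.
  by lra.
(* From [theta2 t <= 1 / 2]. The total coefficient of [P] becomes [m * a / 2], exactly the one in
   [E t]. *)
have P' : Lf * c ^+ 2 * P <= Lf * c / 2 * P.
  apply: ler_wpM2r => //; rewrite expr2 mulrA ler_wpM2l//.
    by rewrite mulr_ge0// ltW.
  by lra.
have D1 : (1 - c) * Lf * D <= m * (1 - a - b - eps) * D by exact: ler_wpM2r.
have D2 : m' * b * D <= m * b * D.
  by apply: ler_wpM2r => //; apply: ler_wpM2r.
(* By [D1] and [D2] the coefficient of [D] is at most [- m * eps / 2]; since [Lf / 2 <= m], this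
   pays for the decrease [Lf * eps / 4]. *)
have D3 : Lf / 2 * (eps * D) <= m * (eps * D).
  by apply: ler_wpM2r => //; rewrite mulr_ge0// ltW.
by lra.
Qed.

Lemma lyapunov_ge t : F (X t) <= E t.
Proof.
have /andP[a0 _] := htheta1 t; have [_ m0] := stepsize_bounds t.
have m1 : 0 <= mu t by apply: le_trans m0; rewrite divr_ge0// ltW.
rewrite lerDl; apply: mulr_ge0; last exact: sqr_ge0.
by rewrite divr_ge0// mulr_ge0.
Qed.

Lemma lyapunov_noninc : nonincreasing_seq E.
Proof.
apply/nonincreasing_seqP => t; apply: le_trans (lyapunov_decrease t).
have /andP[e0 _] := heps.
rewrite lerDl; apply: mulr_ge0; last exact: sqr_ge0.
by rewrite divr_ge0// mulr_ge0// ltW.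
Qed.

Lemma lyapunov_cvg : cvgn E.
Proof.
have [m hm] := F_bdd_below.
apply: nonincreasing_is_cvgn; first exact: lyapunov_noninc.
by exists m => _ [t _ <-]; exact: le_trans (hm _) (lyapunov_ge t).
Qed.

(** All iterates lie in the sublevel set of [F] at height [E 0], which coercivity bounds. *)
Lemma iterates_bounded : exists B : R, forall t, tnorm (X t) <= B.
Proof.
have [K hK] := F_coercive (E 0%N); exists K => t; rewrite leNgt; apply/negP => /hK.
apply/negP; rewrite -leNgt; apply: le_trans (lyapunov_ge t) _.
exact: lyapunov_noninc.
Qed.

(** The squared increments are squeezed by a multiple of [E t - E t.+1], which tends to 0 since [E]
    converges. *)
Lemma increments_cvg0 : tnorm (p t) @[t --> \oo] --> 0.
Proof.
have /andP[e0 _] := heps.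
have c0 : 0 < Lf * eps / 4 by rewrite divr_gt0 ?mulr_gt0.
rewrite -(@cvg_shiftS _ (fun t => tnorm (p t))).
have h2 : tdot (p t.+1) (p t.+1) @[t --> \oo] --> (0 : R).
  apply: (@squeeze_cvgr _ _ _ _ (fun=> 0)
    (fun t => (Lf * eps / 4)^-1 * (E t - E t.+1))).
  - near=> t; rewrite tdot_ge0/= mulrC ler_pdivlMr// mulrC -sqr_tnorm.
    by have := lyapunov_decrease t; lra.
  - exact: cvg_cst.
  - have -> : (0 : R) = (Lf * eps / 4)^-1 * (limn E - limn E) by rewrite subrr mulr0.
    apply: cvgMr; apply: cvgB; first exact: lyapunov_cvg.
    by rewrite (cvg_shiftS E); exact: lyapunov_cvg.
exact: (tnorm_cvg0 h2).
Unshelve. all: by end_near. Qed.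

(** [F (X t)] differs from the convergent [E t] by the inertial term, which vanishes because its
    coefficient is at most [mu 0]. *)
Lemma objF_iterates_cvg : cvgn (fun t => F (X t)).
Proof.
apply/cvg_ex; exists (limn E - 0).
have -> : (fun t => F (X t)) =
    (fun t => E t - mu t * theta1 t / 2 * tnorm (p t) ^+ 2).
  by apply/funext => t; rewrite addrK.
apply: cvgB; first exact: lyapunov_cvg.
apply: (@squeeze_cvgr _ _ _ _ (fun=> 0) (fun t => mu 0%N * tnorm (p t) ^+ 2)).
- near=> t.
  have /andP[e0 e1] := heps.
  have /andP[a0 a1] := htheta1 t; have [_ m0] := stepsize_bounds t.
  have L2 : 0 <= Lf / 2 by rewrite divr_ge0// ltW.
  have m1 := le_trans L2 m0.
  apply/andP; split; first by apply: mulr_ge0 (sqr_ge0 _); rewrite divr_ge0// mulr_ge0.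
  apply: ler_wpM2r; first exact: sqr_ge0.
  apply: le_trans (hmu0 t); rewrite -mulrA -[X in _ <= X]mulr1.
  by apply: ler_wpM2l => //; lra.
- exact: cvg_cst.
- have -> : (0 : R) = mu 0%N * (0 * 0) by rewrite !mulr0.
  by apply: cvgMr; apply: cvgM; exact: increments_cvg0.
Unshelve. all: by end_near. Qed.

(** * Stationarity of accumulation points *)

Section AccumulationPoint.
Variables (Xs : T) (phi : nat -> nat).
Hypothesis phi_inc : {homo phi : m n / (m < n)%N}.
Hypothesis phi_cvg : tcvg (fun l => X (phi l)) Xs.

Lemma increments_subseq_cvg0 : tnorm (p (phi l)) @[l --> \oo] --> 0.
Proof.
apply: (@cvg_comp _ _ _ phi (fun t => tnorm (p t))); last exact: increments_cvg0.
exact: cvgn_strictly_increasing.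
Qed.

(** Minimality concerns the iterate after [phi l], whereas convergence is given at [phi l];
    vanishing increments bridge the two. *)
Lemma next_iterate_cvg : tcvg (fun l => X (phi l).+1) Xs.
Proof.
apply: (tcvg_shift phi_cvg); rewrite /tcvg.
have -> : (fun t => tnorm (tsub (tsub (X (phi t).+1) (X (phi t))) (@tzero R n1 n2 n3)))
    = (fun t => tnorm (p t.+1)) \o phi.
  apply/funext => t /=; congr tnorm; apply: tensorP => k i j; rewrite !mxE; ring.
apply: (@cvg_comp _ _ _ phi (fun t => tnorm (p t.+1))).
  exact: cvgn_strictly_increasing.
by rewrite (cvg_shiftS (fun t => tnorm (p t))); exact: increments_cvg0.
Qed.

Lemma extrap_cvg (theta : nat -> R) : (forall t, `|theta t| <= 1) ->
  tcvg (fun l => extrap X theta (phi l)) Xs.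
Proof.
move=> th1; apply: (tcvg_shift phi_cvg); rewrite /tcvg.
apply: (@cvg_dominated0 _ _ (fun t => tnorm (p (phi t))) _ 1); last first.
  exact: increments_subseq_cvg0.
move=> t; rewrite subr0 ger0_norm ?tnorm_ge0//.
have -> : tsub (tsub (extrap X theta (phi t)) (X (phi t))) (@tzero R n1 n2 n3)
    = tscale (theta (phi t)) (p (phi t)).
  by apply: tensorP => k i j; rewrite !mxE; ring.
by rewrite tnormZ ler_wpM2r ?tnorm_ge0.
Qed.

(** Limit of the subproblem inequality at step [phi l]. The proximal term of the minimizer is
    dropped and [mu (phi l)] is raised to [mu 0] on the competitor's side, so no limit of [mu] has
    to be taken. *)
Lemma accumulation_prox_minimal W :
  lam * h Xs Xs <= lam * h Xs W + tdot (tsub W Xs) (gradf Xs)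
    + mu 0%N / 2 * tnorm (tsub W Xs) ^+ 2.
Proof.
have /andP[e0 e1] := heps.
pose Y l := extrap X theta1 (phi l); pose Z l := extrap X theta2 (phi l).
have cY : tcvg Y Xs.
  apply: extrap_cvg => t; have /andP[a0 a1] := htheta1 t.
  by rewrite ger0_norm//; lra.
have cZ : tcvg Z Xs.
  apply: extrap_cvg => t; have /andP[a0 a1] := htheta2 t.
  by rewrite ger0_norm//; lra.
have cg : tcvg (fun l => gradf (Z l)) (gradf Xs).
  apply: (@cvg_dominated0 _ _ (fun t => tnorm (tsub (Z t) Xs)) _ Lf) => // t.
  by rewrite subr0 ger0_norm ?tnorm_ge0.
have cW : tcvg (fun=> W) W by rewrite /tcvg tnorm_subxx; exact: cvg_cst.
have csub (u v : nat -> T) U V : tcvg u U -> tcvg v V ->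
    forall k i j, tsub (u t) (v t) k i j @[t --> \oo] --> tsub U V k i j.
  move=> /tcvg_entry uU /tcvg_entry vV k i j; rewrite !mxE.
  by under eq_fun do rewrite !mxE; exact: cvgB.
have z0 : tdot (tsub Xs Xs) (gradf Xs) = 0 by rewrite tdotBl subrr.
have cL : lam * h (X (phi l)) (X (phi l).+1)
    + tdot (tsub (X (phi l).+1) (Y l)) (gradf (Z l))
    @[l --> \oo] --> lam * h Xs Xs + 0.
  apply: cvgD.
    apply: cvgMr.
    apply: (linearized_penalty_cvg rho_nonneg rho_deriv rho_concave rho'_lip) => //.
    exact: next_iterate_cvg.
  rewrite -z0; apply: tdot_cvg; last by apply/tcvg_entry.
  by apply: csub => //; exact: next_iterate_cvg.
have cR : lam * h (X (phi l)) W + tdot (tsub W (Y l)) (gradf (Z l))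
    + mu 0%N / 2 * tnorm (tsub W (Y l)) ^+ 2
    @[l --> \oo] --> lam * h Xs W + tdot (tsub W Xs) (gradf Xs)
    + mu 0%N / 2 * tnorm (tsub W Xs) ^+ 2.
  apply: cvgD; first apply: cvgD.
  - apply: cvgMr.
    exact: (linearized_penalty_cvg rho_nonneg rho_deriv rho_concave rho'_lip).
  - by apply: tdot_cvg; [exact: csub|apply/tcvg_entry].
  - under eq_fun do rewrite sqr_tnorm; rewrite sqr_tnorm.
    by apply: cvgMr; apply: tdot_cvg; exact: csub.
rewrite -[X in X <= _]addr0; apply: (ler_cvg_to cL cR); near=> l.
have [_ m0] := stepsize_bounds (phi l).
have m1 : 0 <= mu (phi l) / 2.
  by rewrite divr_ge0//; apply: le_trans m0; rewrite divr_ge0// ltW.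
have s1 := mulr_ge0 m1 (sqr_ge0 (tnorm (tsub (X (phi l).+1) (Y l)))).
have s2 : mu (phi l) / 2 * tnorm (tsub W (Y l)) ^+ 2 <=
    mu 0%N / 2 * tnorm (tsub W (Y l)) ^+ 2.
  by rewrite ler_wpM2r ?sqr_ge0// ler_wpM2r.
have drop (a b c a' b' c' c'' : R) :
    a + b + c <= a' + b' + c' -> 0 <= c -> c' <= c'' -> a + b <= a' + b' + c''.
  by move=> H c0 cc; apply: le_trans (le_trans H (lerD (lexx _) cc)); rewrite lerDl.
exact: drop (hX (phi l) W) s1 s2.
Unshelve. all: by end_near. Qed.

(* To first order at [Xs] the penalty agrees with its linearization, which is
   minimized at [Xs] up to the gradient of [f] and a quadratic term. *)
Lemma accumulation_frechet : frechet_subdiff F Xs (@tzero R n1 n2 n3).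
Proof.
move=> e e0.
have o1 : tlittleo Xs (fun W => f W - f Xs - tdot (gradf Xs) (tsub W Xs)).
  exact: f_grad.
have o2 := tlittleoZ lam
  (penalty_first_order rho_nonneg rho_deriv rho_concave rho'_pos Xs).
(* Three remainders add up: penalty against model, [f] against its gradient, and the quadratic term
   of [accumulation_prox_minimal], negative since it enters a lower bound. *)
have [d d0 hd] := tlittleoD (tlittleoD o2 o1) (tlittleo_sqr (- (mu 0%N / 2)) Xs) e0.
exists d => // W /hd; rewrite ler_norml => /andP[H _]; apply: le_trans H _.
have := accumulation_prox_minimal W.
rewrite tdot0l !objFE (tdotC (gradf Xs)).
move: (penalty _ _) (penalty _ _) (h _ _) (h _ _) (tdot _ _) (f _) (f _).
by move: (tnorm _ ^+ 2) => *; lra.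
Qed.

(** Constant sequences turn a Frechet subgradient into a limiting one. *)
Lemma accumulation_limiting : limiting_subdiff F Xs (@tzero R n1 n2 n3).
Proof.
exists (fun=> Xs), (fun=> @tzero R n1 n2 n3); split.
- by rewrite /tcvg tnorm_subxx; exact: cvg_cst.
- exact: cvg_cst.
- by rewrite /tcvg tnorm_subxx; exact: cvg_cst.
- by move=> _; exact: accumulation_frechet.
Qed.

End AccumulationPoint.
End Iteration.
End Convergence.

Theorem theorem2 (R : realType) (n1 n2 n3 : nat)
  (hn1 : (0 < n1)%N) (hn2 : (0 < n2)%N) (hn3 : (0 < n3)%N)
  (lam : R) (hlam : 0 < lam)
  (* Assumption A1 *)
  (rho rho' : R -> R) (Lg : R)
  (rho_nonneg : forall t, 0 <= t -> 0 <= rho t)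
  (rho_deriv : deriv_on_nonneg rho rho')
  (rho_concave : concave_on_nonneg rho)
  (rho'_lip : forall x y, 0 <= x -> 0 <= y -> `|rho' x - rho' y| <= Lg * `|x - y|)
  (rho'_pos : forall t, 0 <= t -> 0 < rho' t)
  (* Assumption A2 *)
  (f : tensor R n1 n2 n3 -> R) (gradf : tensor R n1 n2 n3 -> tensor R n1 n2 n3)
  (Lf : R) (hLf : 0 < Lf)
  (f_nonneg : forall X, 0 <= f X)
  (f_grad : is_gradient f gradf)
  (gradf_lip : forall X Y, tnorm (tsub (gradf X) (gradf Y)) <= Lf * tnorm (tsub X Y))
  (* Assumption A3 *)
  (F_coercive : forall M : R, exists K : R, forall X,
      K < tnorm X -> M < objF lam rho f X)
  (F_bdd_below : exists m : R, forall X, m <= objF lam rho f X)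
  (* the TNNR iteration and Assumption A4 *)
  (X : nat -> tensor R n1 n2 n3) (theta1 theta2 mu : nat -> R) (eps : R)
  (hX : TNNR_sequence lam rho rho' gradf X theta1 theta2 mu)
  (heps : 0 < eps < 1)
  (htheta1 : forall t, 0 <= theta1 t < (1 - eps) / 2)
  (htheta2 : forall t, 0 <= theta2 t <= 1 / 2)
  (hmu_noninc : forall t, mu t.+1 <= mu t)
  (hmu0 : forall t, mu t <= mu 0%N)
  (hmu1 : forall t, theta2 t * Lf <= mu t * theta1 t)
  (hmu2 : forall t,
      (1 - theta2 t) * Lf / (1 - theta1 t - theta1 t.+1 - eps) <= mu t) :
  (* (i) bounded, with an accumulation point *)
  ((exists B : R, forall t, tnorm (X t) <= B) /\
   (exists (Xs : tensor R n1 n2 n3) (phi : nat -> nat),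
     {homo phi : m n / (m < n)%N} /\ tcvg (fun l => X (phi l)) Xs)) /\
  (* (ii) F(X^t) converges *)
  cvgn (fun t => objF lam rho f (X t)) /\
  (* (iii) every accumulation point is stationary, and F(X^{t_l+1}) -> F(X_star) *)
  (forall (Xs : tensor R n1 n2 n3) (phi : nat -> nat),
     {homo phi : m n / (m < n)%N} -> tcvg (fun l => X (phi l)) Xs ->
     limiting_subdiff (objF lam rho f) Xs (@tzero R n1 n2 n3) /\
     objF lam rho f (X (phi l).+1) @[l --> \oo] --> objF lam rho f Xs).
Proof.
have [B hB] := iterates_bounded hlam rho_nonneg rho_deriv rho_concave rho'_pos
  f_grad gradf_lip hLf F_coercive hX heps htheta1 htheta2 hmu_noninc hmu1 hmu2.
split; first by split; [exists B | exact: tensor_bolzano_weierstrass hB].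
split.
  exact: (objF_iterates_cvg hlam rho_nonneg rho_deriv rho_concave rho'_pos
    f_grad gradf_lip hLf F_bdd_below hX heps htheta1 htheta2 hmu_noninc hmu0
    hmu1 hmu2).
move=> Xs phi phi_inc phi_cvg; split.
  exact: (accumulation_limiting hlam rho_nonneg rho_deriv rho_concave rho'_lip
    rho'_pos f_grad gradf_lip hLf F_bdd_below hX heps htheta1 htheta2 hmu_noninc
    hmu0 hmu1 hmu2 phi_inc phi_cvg).
(* The objective is continuous along convergent sequences, so convergence of the shifted subsequence
   is enough. *)
have cv := next_iterate_cvg hlam rho_nonneg rho_deriv rho_concave rho'_pos f_grad
  gradf_lip hLf F_bdd_below hX heps htheta1 htheta2 hmu_noninc hmu1 hmu2
  phi_inc phi_cvg.
exact: (objF_cvg rho_nonneg rho_deriv rho_concave rho'_pos f_grad gradf_lip cv).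
Qed.
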